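(* Let $n\in\mathbb{N}$, let $C=[c_{ij}]\in\mathbb{R}^{n\times n}$ be a cost matrix, let $r,c\in\mathbb{R}^n$ have positive entries, and assume $\lVert r\rVert_1=\lVert c\rVert_1=1$. Let $\mathcal{F}$ be the optimal face and $\Delta$ the vertex optimality gap of the optimal transport problem $\min_{P\ge 0:\,P\mathbf{1}=r,\,P^{\top}\mathbf{1}=c}C\cdot P$, and let $P_{t,\eta}$ be the result of the Sinkhorn algorithm with entropy regularization parameter $\eta$ after $t$ iterations. There exist constants $q,t_1$ such that, for all $\eta>\frac{1+2\log n}{\Delta}$ and all $t>t_1$, one has $$\mathrm{dist}(\mathcal{F},P_{t,\eta})\le 6n^2\exp(-\eta\Delta)+\frac{\sqrt{q}}{\sqrt{t}}.$$ Therefore, for $\lambda^{\star}=\tau(\mathcal{F})$, it follows (for such $\eta$ and $t$) that $P_{t,\eta}$ is $(\lambda^{\star},\epsilon_{t,\eta})$-sparse, where $$\epsilon_{t,\eta}:=6n^2\exp(-\eta\Delta)+\frac{\sqrt{q}}{\sqrt{t}}.$$ As a result (for such $\eta$ and for $N_1>t_1$), the Hessian matrix $\nabla^2 f(x,y)\in\mathbb{R}^{2n\times 2n}$ of the Lyapunov potential $f$, evaluated at the dual variables $(x,y)$ obtained after $N_1$ Sinkhorn iterations, is $\left(\frac{\lambda^{\star}}{2}+\frac{1}{2n},\,2\epsilon_{N_1,\eta}\right)$-sparse. Define the subset $\mathcal{S}\subset\mathbb{R}^{n\times n}$ so that $C\in\mathcal{S}$ if $C$ is a cost matrix for which $\min_{P\ge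 0:\,P\mathbf{1}=r,\,P^{\top}\mathbf{1}=c}C\cdot P$ has non-unique solutions. Then $\mathcal{S}$ is of Lebesgue measure zero, and so the optimal transport problem $\min_{P\ge 0:\,P\mathbf{1}=r,\,P^{\top}\mathbf{1}=c}C\cdot P$ has a unique solution generically. The generic condition $C\notin\mathcal{S}$ leads to $\lambda^{\star}\le 2/n$. If one further assumes $r=c=\frac1n\mathbf{1}$, then $\lambda^{\star}=1/n$.
   Context: Notation: $\mathbf{1}\in\mathbb{R}^n$ is the all-ones vector; $C\cdot P=\sum_{i,j}c_{ij}p_{ij}$; $\log$ and $\exp$ of vectors and matrices are entrywise; $\lVert M\rVert_1=\sum_{ij}|m_{ij}|$ is the entrywise $\ell_1$ norm; $\lVert M\rVert_0$ is the number of nonzero entries of $M$. Sparsity: for $M\in\mathbb{R}^{m\times k}$, $\tau(M):=\lVert M\rVert_0/(mk)$. A matrix $M\in\mathbb{R}^{m\times k}$ is $(\lambda,\epsilon)$-sparse if there is a matrix $\tilde M$ of the same size with $\tau(\tilde M)\le\lambda$ and $\lVert M-\tilde M\rVert_1\le\epsilon$. Polyhedron: $\mathcal{P}=\{P\in\mathbb{R}^{n\times n}: P\mathbf{1}=r,\ P^{\top}\mathbf{1}=c,\ P\ge 0\}$; $\mathcal{V}$ is the set of vertices of $\mathcal{P}$; $\mathcal{O}=\operatorname{argmin}_{P\in\mathcal{V}}C\cdot P$ is the set of optimal vertices; $\Delta=\min_{Q\in\mathcal{V}\setminus\mathcal{O}}C\cdot Q-\min_{P\in\mathcal{O}}C\cdot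 P$ is the vertex optimality gap (a minimum over the empty set is read as $+\infty$); $\mathcal{F}=\mathrm{Conv}(\mathcal{O})$ is the optimal face, i.e. the set of optimal transport plans; $\tau(\mathcal{F}):=\max_{M\in\mathcal{F}}\tau(M)$ is its sparsity; $\mathrm{dist}(\mathcal{F},P)=\min_{M\in\mathcal{F}}\lVert M-P\rVert_1$. Lyapunov potential: for an entropy regularization parameter $\eta>0$ and $x,y\in\mathbb{R}^n$, $$f(x,y)=-\frac1\eta\sum_{ij}\exp(\eta(-c_{ij}+x_i+y_j)-1)+\sum_i r_ix_i+\sum_j c_jy_j,$$ where $c_j$ denotes the $j$-th entry of the vector $c$ and $c_{ij}$ the entries of $C$. Sinkhorn algorithm: start with a given initialization $(x,y)=(x_{\mathrm{init}},y_{\mathrm{init}})\in\mathbb{R}^n\times\mathbb{R}^n$. One iteration consists of: set $P=\exp(\eta(-C+x\mathbf{1}^{\top}+\mathbf{1}y^{\top})-1)$ and update $x\leftarrow x+(\log r-\log(P\mathbf{1}))/\eta$; then recompute $P=\exp(\eta(-C+x\mathbf{1}^{\top}+\mathbf{1}y^{\top})-1)$ with the new $x$ and update $y\leftarrow y+(\log c-\log(P^{\top}\mathbf{1}))/\eta$. $P_{t,\eta}$ denotes $\exp(\eta(-C+x\mathbf{1}^{\top}+\mathbf{1}y^{\top})-1)$ for the $(x,y)$ obtained after $t$ iterations.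
   Formalization: The constant q is allowed to depend on η (no single q works for all η, while t_1 is uniform), and the Hessian is shown to be (λ*/2+1/(2n), 2ηε)-sparse instead of 2ε, since the Hessian of f carries a factor η; both literal claims are false. *)

(* Defs.v *)
(* MathComp / MathComp-Analysis; vectors of R^n are column vectors 'cV[R]_n. *)
From HB Require Import structures.
From mathcomp Require Import all_boot all_order all_algebra.
From mathcomp Require Import all_classical all_reals all_analysis.

Set Implicit Arguments.
Unset Strict Implicit.
Unset Printing Implicit Defensive.

Import Order.TTheory GRing.Theory Num.Theory.
Import numFieldNormedType.Exports.

Local Open Scope classical_set_scope.
Local Open Scope ring_scope.

Section Sparsity.
Variable R : realType.

(* The norm `|M| of the library is the maximum norm. *)
Definition norm1 (m k : nat) (M : 'M[R]_(m, k)) : R :=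
  \sum_(i < m) \sum_(j < k) `|M i j|.

Definition norm0 (m k : nat) (M : 'M[R]_(m, k)) : nat :=
  #|[set p : 'I_m * 'I_k | M p.1 p.2 != 0]|.

Definition tau (m k : nat) (M : 'M[R]_(m, k)) : R :=
  (norm0 M)%:R / (m * k)%:R.

Definition is_sparse (m k : nat) (lambda eps : R) (M : 'M[R]_(m, k)) : Prop :=
  exists M' : 'M[R]_(m, k), tau M' <= lambda /\ norm1 (M - M') <= eps.

(* tau takes finitely many values, so over a nonempty set of matrices the
   supremum is a maximum. *)
Definition tau_set (m k : nat) (F : set 'M[R]_(m, k)) : R :=
  sup [set tau M | M in F].

Definition dist1 (m k : nat) (F : set 'M[R]_(m, k)) (P : 'M[R]_(m, k)) : R :=
  inf [set norm1 (M - P) | M in F].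

End Sparsity.

Section OptimalTransport.
Variables (R : realType) (n : nat).
Implicit Types (C P Q : 'M[R]_n) (r c x y : 'cV[R]_n) (A : set 'M[R]_n).

Definition ones : 'cV[R]_n := const_mx 1.

Definition cost C P : R := \sum_(i < n) \sum_(j < n) C i j * P i j.

Definition polytope r c : set 'M[R]_n :=
  [set P | [/\ P *m ones = r, P^T *m ones = c & forall i j, 0 <= P i j]].

(* Vertices as extreme points. *)
Definition vertices r c : set 'M[R]_n :=
  [set P | polytope r c P /\
    forall (Q S : 'M[R]_n) (s : R), polytope r c Q -> polytope r c S ->
      0 < s < 1 -> P = s *: Q + (1 - s) *: S -> Q = P /\ S = P].

Definition opt_vertices C r c : set 'M[R]_n :=
  [set P | vertices r c P /\ forall Q, vertices r c Q -> cost C P <= cost C Q].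

(* Extended-real valued: +oo when every vertex is optimal, because
   ereal_inf set0 = +oo. *)
Definition vertex_gap C r c : \bar R :=
  (ereal_inf [set (cost C Q)%:E | Q in vertices r c `\` opt_vertices C r c]
   - ereal_inf [set (cost C P)%:E | P in opt_vertices C r c])%E.

Definition conv_hull A : set 'M[R]_n :=
  [set M | exists (m : nat) (w : 'I_m -> R) (V : 'I_m -> 'M[R]_n),
    [/\ forall k, 0 <= w k, \sum_(k < m) w k = 1, forall k, A (V k)
      & M = \sum_(k < m) w k *: V k]].

Definition opt_face C r c : set 'M[R]_n := conv_hull (opt_vertices C r c).

Definition ot_solution C r c : set 'M[R]_n :=
  [set P | polytope r c P /\ forall Q, polytope r c Q -> cost C P <= cost C Q].

Definition nonunique_costs r c : set 'M[R]_n :=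
  [set C | exists P Q, [/\ ot_solution C r c P, ot_solution C r c Q & P <> Q]].

(* Lebesgue measure zero in R^(n x n) = R^(n^2): for every e > 0, A is covered
   by countably many closed boxes of total volume at most e.  (The library has
   no Lebesgue measure on R^(n^2).) *)
Definition lebesgue_null A : Prop :=
  forall e : R, 0 < e -> exists a b : nat -> 'M[R]_n,
    [/\ forall k i j, a k i j <= b k i j,
        A `<=` \bigcup_k [set M | forall i j, a k i j <= M i j <= b k i j]
      & (\sum_(0 <= k <oo)
           (\prod_(i < n) \prod_(j < n) (b k i j - a k i j))%:E <= e%:E)%E].

Definition plan C (eta : R) x y : 'M[R]_n :=
  \matrix_(i, j) expR (eta * (- C i j + x i 0 + y j 0) - 1).

Definition update_x C r (eta : R) x y : 'cV[R]_n :=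
  x + eta^-1 *: (map_mx (@ln R) r - map_mx (@ln R) (plan C eta x y *m ones)).

Definition update_y C c (eta : R) x y : 'cV[R]_n :=
  y + eta^-1 *:
    (map_mx (@ln R) c - map_mx (@ln R) ((plan C eta x y)^T *m ones)).

Definition sinkhorn_step C r c (eta : R) (z : 'cV[R]_n * 'cV[R]_n) :
    'cV[R]_n * 'cV[R]_n :=
  let x := update_x C r eta z.1 z.2 in (x, update_y C c eta x z.2).

Definition sinkhorn C r c (eta : R) x0 y0 (t : nat) : 'cV[R]_n * 'cV[R]_n :=
  iter t (sinkhorn_step C r c eta) (x0, y0).

Definition sinkhorn_plan C r c (eta : R) x0 y0 (t : nat) : 'M[R]_n :=
  let z := sinkhorn C r c eta x0 y0 t in plan C eta z.1 z.2.

Definition lyapunov C r c (eta : R) x y : R :=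
  - (eta^-1 * \sum_(i < n) \sum_(j < n)
                expR (eta * (- C i j + x i 0 + y j 0) - 1))
  + \sum_(i < n) r i 0 * x i 0 + \sum_(j < n) c j 0 * y j 0.

(* At z = (x, y) and with P = plan C eta x y, this is
   - eta *: block_mx (diag (P 1)) P P^T (diag (P^T 1)):  the Hessian carries a
   factor eta that P does not. *)
Definition lyapunov_hessian C r c (eta : R) x y : 'M[R]_(n + n) :=
  let f := fun z : 'cV[R]_(n + n) =>
    lyapunov C r c eta (usubmx z) (dsubmx z) in
  \matrix_(i, j) 'D_(delta_mx j 0) ('D_(delta_mx i 0) f) (col_mx x y).

(* expeR (- (eta%:E * Delta)) is 0 if Delta = +oo (and eta > 0). *)
Definition sinkhorn_error (eta : R) (Delta : \bar R) (q : R) (t : nat) : R :=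
  6 * n%:R ^+ 2 * fine (expeR (- (eta%:E * Delta))%E)
  + Num.sqrt q / Num.sqrt t%:R.

End OptimalTransport.

(* Main.v *)
Require Import Defs.
From HB Require Import structures.
From mathcomp Require Import all_boot all_order all_algebra.
From mathcomp Require Import all_classical all_reals all_analysis.
From mathcomp Require Import ring lra.

(** The argument has four independent parts.

    Distance to the optimal face.  Let [P] be the plan after [t >= 1] Sinkhorn
    iterations.  Its column marginals are exactly [c], and the l1 error of its
    row marginals decays geometrically: the entries of [P] are bounded below
    uniformly in [t] because the cross-ratios of a Gibbs plan do not change under
    scaling ([plan_cross_ratio], [sinkhorn_plan_lower]), so one iteration is a
    Doeblin contraction of the error ([scaling_contraction]).  Correcting the row
    marginals of [P] gives a plan [Q] of the polytope close to [P].  Write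
    [Q = (1 - mu) X + mu Z] with [X] on the optimal face and [Z] costlier than the
    optimum by at least the gap Delta ([face_split]).  Since [ln P] is
    [- eta * C] up to a function of the marginals, replacing [Q] by [X] decreases
    the cost by at least [mu * Delta], while it lowers the entropy by at most
    [mu * (2 ln n + 1 - ln mu)] up to the chi-square distance of [Q] to [P].
    Hence [mu <= e n^2 exp (- eta Delta)] up to that distance
    ([entropic_mixture]), and [2 e <= 6].  This compares [P] with the face
    directly, without the entropic optimum.  Geometric decay is faster than
    [1 / sqrt t]; all constants may depend on [eta], and [t1 = 0] suffices.

    Hessian.  The second derivatives of the potential form, up to the factor
    [- eta], the block matrix with off-diagonal blocks [P] and [P^T] and diagonal
    matrices on the diagonal ([lyapunov_hessian_block]).  Replacing [P] by the
    point [X] of the face in the off-diagonal blocks gives the sparse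
    approximation.

    Generic uniqueness.  The polytope is the convex hull of its vertices
    ([polytope_ind]: a non-vertex can be moved in two opposite directions until
    its support shrinks), and a vertex is determined by its support, so there
    are finitely many vertices.  If the optimal plan is not unique, two distinct
    vertices [V] and [W] are optimal, and [C] is orthogonal to [V - W]: such [C]
    lie on finitely many hyperplanes, which are covered by boxes of small volume
    ([hyperplane_null]).

    Sparsity of vertices.  A vertex admits no nonzero matrix with zero marginals
    supported on its support ([vertex_rigid]).  Counting unknowns and equations,
    its support has at most [2 n] entries; for uniform marginals, the entries
    strictly between [0] and [1/n] occur at least twice in every row and column
    that they meet, so the same count excludes them, and the support has exactly
    [n] entries ([uniform_vertex_norm0]). *)

Set Implicit Arguments.
Unset Strict Implicit.
Unset Printing Implicit Defensive.

Import Order.TTheory GRing.Theory Num.Theory.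
Import numFieldNormedType.Exports.

Local Open Scope classical_set_scope.
Local Open Scope ring_scope.

(** * Convex sets and vertices of the transport polytope *)

(** A finite family of positive numbers has a positive lower bound. *)
Lemma pos_lower_bound (R : realType) (T : finType) (f : T -> R) :
  (forall t, 0 < f t) -> exists2 e : R, 0 < e & forall t, e <= f t.
Proof.
move=> f0; exists (\big[Order.min/1]_t f t); first exact: lt_bigmin.
by move=> t; exact: bigmin_le.
Qed.

Lemma norm0E (R : realType) m k (M : 'M[R]_(m, k)) :
  norm0 M = #|[pred p : 'I_m * 'I_k | M p.1 p.2 != 0]|.
Proof. by apply: eq_card => p; apply/idP/idP => [/set_mem|/mem_set]. Qed.

Section TransportPolytope.
Variables (R : realType) (n : nat).
Implicit Types (C P Q S D : 'M[R]_n) (r c : 'cV[R]_n) (A B : set 'M[R]_n).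

(** Convexity of a set of matrices, with the weights of [conv_hull]. *)
Definition is_convex A : Prop := forall P Q s,
  A P -> A Q -> 0 <= s <= 1 -> A (s *: P + (1 - s) *: Q).

(** Tangent directions of the affine space of matrices with given marginals. *)
Definition zero_marginals D : Prop :=
  (forall i, \sum_j D i j = 0) /\ (forall j, \sum_i D i j = 0).

Lemma polytopeP r c P : polytope r c P <->
  [/\ forall i, \sum_j P i j = r i 0, forall j, \sum_i P i j = c j 0
    & forall i j, 0 <= P i j].
Proof.
split=> [[<- <- P0]|[Pr Pc P0]]; split => //.
- by move=> i; rewrite mxE; apply: eq_bigr => j _; rewrite mxE mulr1.
- by move=> i; rewrite mxE; apply: eq_bigr => j _; rewrite !mxE mulr1.
- apply/colP => i; rewrite mxE -Pr.
  by apply: eq_bigr => j _; rewrite mxE mulr1.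
- apply/colP => i; rewrite mxE -Pc.
  by apply: eq_bigr => j _; rewrite !mxE mulr1.
Qed.

Lemma zero_marginalsB r c P Q :
  polytope r c P -> polytope r c Q -> zero_marginals (P - Q).
Proof.
move=> /polytopeP[Pr Pc _] /polytopeP[Qr Qc _]; split => [i|j].
  by under eq_bigr do rewrite !mxE; rewrite big_split sumrN /= Pr Qr subrr.
by under eq_bigr do rewrite !mxE; rewrite big_split sumrN /= Pc Qc subrr.
Qed.

Lemma zero_marginalsZ a D : zero_marginals D -> zero_marginals (a *: D).
Proof.
move=> [Dr Dc]; split=> [i|j].
  by under eq_bigr do rewrite mxE; rewrite -mulr_sumr Dr mulr0.
by under eq_bigr do rewrite mxE; rewrite -mulr_sumr Dc mulr0.
Qed.

Lemma polytopeD r c P D : polytope r c P -> zero_marginals D ->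
  (forall i j, 0 <= P i j + D i j) -> polytope r c (P + D).
Proof.
move=> /polytopeP[Pr Pc _] [Dr Dc] PD; apply/polytopeP; split => [i|j|i j].
- by under eq_bigr do rewrite mxE; rewrite big_split /= Pr Dr addr0.
- by under eq_bigr do rewrite mxE; rewrite big_split /= Pc Dc addr0.
- by rewrite mxE.
Qed.

(** At a vertex, no tangent direction is supported on the support. *)
Lemma vertex_rigid r c P D : vertices r c P -> zero_marginals D ->
  (forall i j, P i j = 0 -> D i j = 0) -> D = 0.
Proof.
move=> [Ppol Pext] D0 suppD.
have /polytopeP[_ _ P0] := Ppol.
pose f (p : 'I_n * 'I_n) : R := if P p.1 p.2 == 0 then 1
  else P p.1 p.2 / (`|D p.1 p.2| + 1).
have f0 p : 0 < f p.
  rewrite /f; case: eqP => // /eqP Pp; rewrite divr_gt0 ?ltr_wpDl//.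
  by rewrite lt_neqAle eq_sym Pp P0.
have [e e0 ef] := pos_lower_bound f0.
have eD i j : e * `|D i j| <= P i j.
  have := ef (i, j); rewrite /f /=; case: eqP => [Pij _|_].
    by rewrite suppD// normr0 mulr0.
  rewrite ler_pdivlMr ?ltr_wpDl// => /(le_trans _); apply.
  by rewrite ler_wpM2l ?(ltW e0)// lerDl.
have pol a : `|a| = e -> polytope r c (P + a *: D).
  move=> ae; apply: polytopeD => //; first exact: zero_marginalsZ.
  move=> i j; rewrite mxE.
  have := eD i j; rewrite -ae -normrM => /(lerB _) => /(_ _ _ (lexx (P i j))).
  have := ler_norm (- (a * D i j)); rewrite normrN; have := P0 i j.
  by have := eD i j; rewrite -ae -normrM; lra.
have [] := Pext (P + e *: D) (P + (- e) *: D) (2^-1).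
- by apply: pol; rewrite gtr0_norm.
- by apply: pol; rewrite normrN gtr0_norm.
- by apply/andP; split; lra.
- by apply/matrixP => i j; rewrite !mxE; field.
move=> /eqP; rewrite addrC -subr_eq0 addrK scaler_eq0 (gt_eqF e0) /=.
by move=> /eqP.
Qed.

(** Moving along a nonzero tangent direction until an entry vanishes makes the
    support strictly smaller. *)
Lemma polytope_exit r c P D : polytope r c P -> zero_marginals D -> D != 0 ->
  (forall i j, P i j = 0 -> D i j = 0) ->
  exists a, [/\ 0 < a, polytope r c (P + a *: D)
    & (norm0 (P + a *: D)%R < norm0 P)%N].
Proof.
move=> Ppol D0 Dn0 suppD; have /polytopeP[_ _ P0] := Ppol.
have [p0 Dp0] : exists p : 'I_n * 'I_n, D p.1 p.2 < 0.
  apply/not_existsP => Dge0; case/eqP: Dn0; apply/matrixP => i j.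
  rewrite mxE; have [/(_ i) Di _] := D0.
  have Dij k : 0 <= D i k by rewrite leNgt; apply/negP; exact: (Dge0 (i, k)).
  by have /psumr_eq0P := Di; apply.
pose F (p : 'I_n * 'I_n) := P p.1 p.2 / - D p.1 p.2.
have /= [p Dp pmin] :=
  @arg_minP _ _ _ _ [pred p : 'I_n * 'I_n | D p.1 p.2 < 0] F Dp0.
have {}Dp : D p.1 p.2 < 0 by [].
have NDp : 0 < - D p.1 p.2 by rewrite oppr_gt0.
have Pp : 0 < P p.1 p.2.
  rewrite lt_neqAle P0 andbT eq_sym; apply/eqP => /suppD Dp1.
  by move: Dp; rewrite Dp1 ltxx.
have Fp : 0 < F p by rewrite divr_gt0.
exists (F p); split => //.
  apply: polytopeD => //; first exact: zero_marginalsZ.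
  move=> i j; rewrite mxE; have [Dij|Dij] := leP 0 (D i j).
    by rewrite addr_ge0 // mulr_ge0 // ltW.
  have := pmin (i, j) Dij; rewrite {2}/F /= ler_pdivlMr ?oppr_gt0//.
  by rewrite mulrN; lra.
rewrite !norm0E; apply: proper_card; apply/properP; split.
  apply/fintype.subsetP => -[i j]; rewrite !inE /= !mxE; apply: contraNneq.
  by move=> Pij; rewrite Pij suppD// mulr0 addr0.
exists p; rewrite !inE ?(gt_eqF Pp)// !mxE negbK; apply/eqP.
by rewrite /F; field; rewrite lt_eqF.
Qed.

(** Every point of the polytope is a convex combination of vertices, in the
    form of an induction principle. *)
Lemma polytope_ind r c A : is_convex A -> vertices r c `<=` A ->
  polytope r c `<=` A.
Proof.
move=> Aconv VA P; have [k] := ubnP (norm0 P).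
elim: k P => // k IH P; rewrite ltnS => Pk Ppol.
have [PV|PV] := pselect (vertices r c P); first exact: VA.
have [D [D0 Dn0 suppD]] : exists D, [/\ zero_marginals D, D != 0
    & forall i j, P i j = 0 -> D i j = 0].
  move/not_andP: PV => [//|] /existsNP[Q] /existsNP[S] /existsNP[s].
  move=> /not_implyP[Qpol] /not_implyP[Spol] /not_implyP[/andP[s0 s1]].
  move=> /not_implyP[PE QS]; exists (Q - S); split.
  - exact: (zero_marginalsB Qpol Spol).
  - apply/eqP => /subr0_eq QE; apply: QS; rewrite PE QE -scalerDl.
    by rewrite addrC subrK scale1r.
  - move=> i j; rewrite PE !mxE.
    have /polytopeP[_ _ Q0] := Qpol; have /polytopeP[_ _ S0] := Spol.
    move/eqP; rewrite paddr_eq0 ?mulr_ge0 ?subr_ge0 ?(ltW s0) ?(ltW s1)//.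
    by rewrite !mulf_eq0 subr_eq0 (gt_eqF s0) (gt_eqF s1) /=
      => /andP[/eqP-> /eqP->]; rewrite subrr.
have [a [a0 Pa na]] := polytope_exit Ppol D0 Dn0 suppD.
have [b [b0 Pb nb]] : exists b, [/\ 0 < b, polytope r c (P + b *: - D)
    & (norm0 (P + b *: - D)%R < norm0 P)%N].
  apply: polytope_exit => //; rewrite ?oppr_eq0//.
    by rewrite -scaleN1r; exact: zero_marginalsZ.
  by move=> i j /suppD; rewrite mxE => ->; rewrite oppr0.
have -> : P = (b / (a + b)) *: (P + a *: D)
            + (1 - b / (a + b)) *: (P + b *: - D).
  by apply/matrixP => i j; rewrite !mxE; field; rewrite gt_eqF// addr_gt0.
apply: Aconv.
- by apply: IH => //; exact: leq_trans Pk.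
- by apply: IH => //; exact: leq_trans Pk.
- by rewrite divr_ge0 ?ler_pdivrMr ?mul1r ?lerDr ?addr_ge0 ?addr_gt0 ?ltW.
Qed.

(** A vertex is determined by its support. *)
Lemma vertex_supp_inj r c P Q : vertices r c P -> vertices r c Q ->
  (forall i j, (P i j == 0) = (Q i j == 0)) -> P = Q.
Proof.
move=> PV QV PQ; apply/subr0_eq; apply: (vertex_rigid PV).
  exact: zero_marginalsB (PV.1) (QV.1).
by move=> i j Pij; rewrite !mxE Pij; have := PQ i j; rewrite Pij eqxx
  => /esym/eqP->; rewrite subrr.
Qed.

Lemma vertices_finite r c : finite_set (vertices r c).
Proof.
pose supp P : {ffun 'I_n * 'I_n -> bool} := [ffun p => P p.1 p.2 == 0].
pose pick g := xget 0 [set P | vertices r c P /\ supp P = g].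
apply: (@sub_finite_set _ _ [set pick g | g in setT]); last first.
  by apply: finite_image; exact: finite_finset.
move=> P PV; exists (supp P) => //; rewrite /pick; case: xgetP => [Q _ [QV QP]|].
  apply: vertex_supp_inj QV PV _ => i j.
  by have := congr1 (fun g : {ffun _ -> bool} => g (i, j)) QP; rewrite !ffunE.
by move=> /(_ P) /not_andP[].
Qed.

Lemma polytope_convex r c : is_convex (polytope r c).
Proof.
move=> P Q s /polytopeP[Pr Pc P0] /polytopeP[Qr Qc Q0] /andP[s0 s1].
apply/polytopeP; split => [i|j|i j].
- under eq_bigr do rewrite !mxE.
  by rewrite big_split /= -!mulr_sumr Pr Qr -mulrDl addrC subrK mul1r.
- under eq_bigr do rewrite !mxE.
  by rewrite big_split /= -!mulr_sumr Pc Qc -mulrDl addrC subrK mul1r.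
- by rewrite !mxE addr_ge0// mulr_ge0// subr_ge0.
Qed.

Lemma cost_is_linear C : linear (cost C).
Proof.
move=> a P Q; rewrite /cost scaler_sumr -big_split; apply: eq_bigr => i _ /=.
rewrite scaler_sumr -big_split; apply: eq_bigr => j _ /=; rewrite !mxE.
by rewrite mulrDr mulrCA.
Qed.

Lemma costD C P Q : cost C (P + Q) = cost C P + cost C Q.
Proof. by have := cost_is_linear C 1 P Q; rewrite !scale1r. Qed.

Lemma costZ C a P : cost C (a *: P) = a * cost C P.
Proof.
have c0 : cost C 0 = 0.
  by rewrite /cost big1// => i _; rewrite big1// => j _; rewrite mxE mulr0.
by have := cost_is_linear C a P 0; rewrite c0 !addr0.
Qed.

Lemma cost_ge_convex C m : is_convex [set P | m <= cost C P].
Proof.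
move=> P Q s /= mP mQ /andP[s0 s1]; rewrite costD !costZ.
have : s * m <= s * cost C P by rewrite ler_wpM2l.
have : (1 - s) * m <= (1 - s) * cost C Q by rewrite ler_wpM2l// subr_ge0.
by lra.
Qed.

Lemma convexI A B : is_convex A -> is_convex B -> is_convex (A `&` B).
Proof. by move=> cA cB P Q s [AP BP] [AQ BQ] s01; split; [apply: cA|apply: cB]. Qed.

Lemma conv_hull_convex A : is_convex (conv_hull A).
Proof.
move=> _ _ s [m1 [w1 [V1 [w10 w11 A1 ->]]]] [m2 [w2 [V2 [w20 w21 A2 ->]]]].
move=> /andP[s0 s1].
exists (m1 + m2)%N, (fun k => match fintype.split k with
  | inl i => s * w1 i | inr j => (1 - s) * w2 j end),
  (fun k => match fintype.split k with inl i => V1 i | inr j => V2 j end).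
split.
- by move=> k; case: fintype.split => i; rewrite mulr_ge0// subr_ge0.
- rewrite big_split_ord /=.
  under eq_bigr do rewrite (unsplitK (inl _)).
  under [in X in _ + X]eq_bigr do rewrite (unsplitK (inr _)).
  by rewrite -!mulr_sumr w11 w21 !mulr1 addrC subrK.
- by move=> k; case: fintype.split.
- rewrite big_split_ord /=.
  under [in RHS]eq_bigr do rewrite (unsplitK (inl _)).
  under [in X in _ = _ + X]eq_bigr do rewrite (unsplitK (inr _)).
  by rewrite !scaler_sumr; congr (_ + _); apply: eq_bigr => k _; rewrite scalerA.
Qed.

Lemma sub_conv_hull A : A `<=` conv_hull A.
Proof.
move=> P AP; exists 1%N, (fun=> 1), (fun=> P); split => //.
- by rewrite big_ord1.
- by rewrite big_ord1 scale1r.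
Qed.

(** A convex set is closed under convex combinations of any length. *)
Lemma conv_hull_sub A B : is_convex B -> A `<=` B -> conv_hull A `<=` B.
Proof.
move=> Bconv AB _ [m [w [V [w0 w1 AV ->]]]].
elim: m w V w0 w1 AV => [|m IH] w V w0 w1 AV.
  by move: w1; rewrite big_ord0 => /esym/eqP; rewrite oner_eq0.
rewrite big_ord_recl; move: w1; rewrite big_ord_recl => w1.
set u := \sum_(i < m) _ in w1.
have [u0|un0] := eqVneq u 0.
  have wl i : w (lift ord0 i) = 0.
    by have /psumr_eq0P := u0; apply => // k _; exact: w0.
  rewrite big1 ?addr0; last by move=> i _; rewrite wl scale0r.
  by move: w1; rewrite u0 addr0 => ->; rewrite scale1r; exact: AB.
have u_ge0 : 0 <= u by apply: sumr_ge0 => i _; exact: w0.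
have -> : \sum_(i < m) w (lift ord0 i) *: V (lift ord0 i) =
    (1 - w ord0) *: \sum_(i < m) (w (lift ord0 i) / u) *: V (lift ord0 i).
  have -> : 1 - w ord0 = u by rewrite -w1 addrC addKr.
  rewrite scaler_sumr; apply: eq_bigr => i _; rewrite scalerA; congr (_ *: _).
  by rewrite mulrC divfK.
apply: Bconv; first exact: AB.
  apply: IH => [i||i]; [by rewrite divr_ge0| |exact: AV].
  by rewrite -mulr_suml divff.
by rewrite w0 -w1 lerDl.
Qed.

End TransportPolytope.

(** * Optimal vertices and the vertex gap *)

Lemma seq_argmin (R : realType) (T : eqType) (f : T -> R) (s : seq T) x :
  x \in s -> exists2 y, y \in s & forall z, z \in s -> f y <= f z.
Proof.
elim: s x => // a s IH x _; case: s IH => [_|b s IH].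
  by exists a; rewrite ?mem_head// => z; rewrite inE => /eqP->.
have [y ys ymin] := IH b (mem_head _ _).
have [fay|fya] := leP (f a) (f y).
- exists a; rewrite ?mem_head// => z; rewrite inE => /orP[/eqP->//|/ymin].
  exact: le_trans.
- exists y; first by rewrite inE ys orbT.
  by move=> z; rewrite inE => /orP[/eqP->|/ymin//]; exact: ltW.
Qed.

(** A nonnegative combination of two points of a convex set is a multiple of one
    point; the total weight may be [0]. *)
Lemma convex_join2 (R : realType) n (A : set 'M[R]_n) X Y a b : is_convex A ->
  A X -> A Y -> 0 <= a -> 0 <= b ->
  exists2 W, A W & a *: X + b *: Y = (a + b) *: W.
Proof.
move=> Aconv AX AY a0 b0; have [ab0|abn0] := eqVneq (a + b) 0.
  exists X => //; have /eqP := ab0; rewrite paddr_eq0// => /andP[/eqP-> /eqP->].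
  by rewrite addr0 !scale0r addr0.
have ab : 0 < a + b by rewrite lt_neqAle eq_sym abn0 addr_ge0.
exists ((a / (a + b)) *: X + (1 - a / (a + b)) *: Y).
  by apply: Aconv; rewrite ?divr_ge0 ?ler_pdivrMr ?mul1r ?lerDl// ltW.
rewrite scalerDr !scalerA; congr (_ *: _ + _ *: _); field; exact: abn0.
Qed.

(** The segments joining two convex sets fill a convex set. *)
Lemma join_convex (R : realType) n (A B : set 'M[R]_n) :
  is_convex A -> is_convex B ->
  is_convex [set P | exists X Z mu,
    [/\ A X, B Z, 0 <= mu <= 1 & P = (1 - mu) *: X + mu *: Z]].
Proof.
move=> Ac Bc _ _ s [X1 [Z1 [mu [AX1 BZ1 /andP[mu0 mu1] ->]]]]
  [X2 [Z2 [nu [AX2 BZ2 /andP[nu0 nu1] ->]]]]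
  /andP[s0 s1].
have s1' : 0 <= 1 - s by rewrite subr_ge0.
have mu1' : 0 <= 1 - mu by rewrite subr_ge0.
have nu1' : 0 <= 1 - nu by rewrite subr_ge0.
have [X AX XE] := convex_join2 Ac AX1 AX2 (mulr_ge0 s0 mu1') (mulr_ge0 s1' nu1').
have [Z BZ ZE] := convex_join2 Bc BZ1 BZ2 (mulr_ge0 s0 mu0) (mulr_ge0 s1' nu0).
exists X, Z, (s * mu + (1 - s) * nu); split => //.
  rewrite addr_ge0 ?mulr_ge0//=.
  have : 0 <= s * (1 - mu) by rewrite mulr_ge0.
  have : 0 <= (1 - s) * (1 - nu) by rewrite mulr_ge0.
  by lra.
have -> : 1 - (s * mu + (1 - s) * nu) = s * (1 - mu) + (1 - s) * (1 - nu).
  by ring.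
rewrite -XE -ZE !scalerDr !scalerA -!addrA; congr (_ + _).
by rewrite addrCA.
Qed.

Section Optimal.
Variables (R : realType) (n : nat) (r c : 'cV[R]_n).
Hypotheses (r_gt0 : forall i, 0 < r i 0) (c_gt0 : forall i, 0 < c i 0).
Hypotheses (r_sum1 : norm1 r = 1) (c_sum1 : norm1 c = 1).
Implicit Types (C P Q V X Z : 'M[R]_n).

Lemma norm1_marginal (u : 'cV[R]_n) : (forall i, 0 < u i 0) ->
  norm1 u = \sum_i u i 0.
Proof. by move=> u0; apply: eq_bigr => i _; rewrite big_ord1 gtr0_norm. Qed.

Lemma sum_r : \sum_i r i 0 = 1. Proof. by rewrite -norm1_marginal. Qed.
Lemma sum_c : \sum_i c i 0 = 1. Proof. by rewrite -norm1_marginal. Qed.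

Lemma polytope_neq0 : exists P, polytope r c P.
Proof.
exists (\matrix_(i, j) (r i 0 * c j 0)); apply/polytopeP; split => [i|j|i j].
- by under eq_bigr do rewrite mxE; rewrite -mulr_sumr sum_c mulr1.
- by under eq_bigr do rewrite mxE; rewrite -mulr_suml sum_r mul1r.
- by rewrite mxE mulr_ge0// ltW.
Qed.

Lemma vertices_neq0 : exists V, vertices r c V.
Proof.
apply/not_existsP => noV; have [P Ppol] := polytope_neq0.
have empty : polytope r c `<=` set0 by apply: polytope_ind => // V /noV.
exact: empty Ppol.
Qed.

Lemma opt_vertices_neq0 C : exists V, opt_vertices C r c V.
Proof.
have [V VV] := vertices_neq0; have /finite_seqP[s sE] := vertices_finite r c.
have [|W Ws Wmin] := @seq_argmin _ _ (cost C) s V.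
  by move: VV; rewrite sE.
by exists W; split=> [|Q]; rewrite sE//; exact: Wmin.
Qed.

Lemma opt_vertices_cost C V W :
  opt_vertices C r c V -> opt_vertices C r c W -> cost C V = cost C W.
Proof.
by move=> [VV Vmin] [WV Wmin]; apply/eqP; rewrite eq_le Vmin// Wmin.
Qed.

Lemma opt_vertex_solution C : opt_vertices C r c `<=` ot_solution C r c.
Proof.
move=> V [VV Vmin]; split; first exact: VV.1.
by apply: polytope_ind; [exact: cost_ge_convex|exact: Vmin].
Qed.

Lemma ot_solution_convex C : is_convex (ot_solution C r c).
Proof.
move=> P Q s [Ppol Pmin] [Qpol Qmin] s01; split; first exact: polytope_convex.
move=> S Spol; rewrite costD !costZ.
have /andP[s0 s1] := s01.
have : s * cost C P <= s * cost C S by rewrite ler_wpM2l// Pmin.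
have : (1 - s) * cost C Q <= (1 - s) * cost C S.
  by rewrite ler_wpM2l ?subr_ge0// Qmin.
by lra.
Qed.

Lemma opt_face_solution C : opt_face C r c `<=` ot_solution C r c.
Proof.
by apply: conv_hull_sub; [exact: ot_solution_convex|exact: opt_vertex_solution].
Qed.

Lemma ot_solution_neq0 C : exists P, ot_solution C r c P.
Proof.
by have [V /opt_vertex_solution] := opt_vertices_neq0 C; exists V.
Qed.

Lemma vertex_gapE C V : opt_vertices C r c V ->
  vertex_gap C r c = (ereal_inf [set (cost C Q)%:E |
     Q in vertices r c `\` opt_vertices C r c] - (cost C V)%:E)%E.
Proof.
move=> VO; rewrite /vertex_gap.
suff -> : [set (cost C P)%:E | P in opt_vertices C r c] = [set (cost C V)%:E].
  by rewrite ereal_inf1.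
apply/seteqP; split => [_ [W WO <-]|_ ->]; last by exists V.
by rewrite (opt_vertices_cost WO VO).
Qed.

Lemma vertex_gap_ge0 C : (0 <= vertex_gap C r c)%E.
Proof.
have [V VO] := opt_vertices_neq0 C; rewrite (vertex_gapE VO) sube_ge0//.
by apply: le_ereal_inf_tmp => _ [Q [QV _] <-]; rewrite lee_fin VO.2.
Qed.

Lemma vertex_gap_le C V Q : opt_vertices C r c V ->
  vertices r c Q -> ~ opt_vertices C r c Q ->
  (vertex_gap C r c <= (cost C Q - cost C V)%:E)%E.
Proof.
move=> VO QV QO; rewrite (vertex_gapE VO) EFinB leeB//.
by apply: ereal_inf_lbound; exists Q.
Qed.

(** A plan splits into a part on the optimal face and a part whose cost exceeds
    the optimum by at least the vertex gap. *)
Lemma face_split C V Q : opt_vertices C r c V -> polytope r c Q ->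
  exists X Z mu, [/\ opt_face C r c X, polytope r c Z, 0 <= mu <= 1,
    Q = (1 - mu) *: X + mu *: Z &
    mu = 0 \/ exists2 d, vertex_gap C r c = d%:E & cost C V + d <= cost C Z].
Proof.
move=> VO Qpol; have [allopt|] := pselect (vertices r c `<=` opt_vertices C r c).
  exists Q, Q, 0; rewrite lexx ler01 subr0 scale1r scale0r addr0; split=> //.
    apply: polytope_ind Qpol; first exact: conv_hull_convex.
    by apply: subset_trans allopt _; exact: sub_conv_hull.
  by left.
move=> /existsNP[W /not_implyP[WV WO]].
have := vertex_gap_le VO WV WO; have := vertex_gap_ge0 C.
case E : (vertex_gap C r c) => [d| |] // _ _.
pose B := polytope r c `&` [set P | cost C V + d <= cost C P].
have Bconv : is_convex B.
  by apply: convexI; [exact: polytope_convex|exact: cost_ge_convex].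
have VB P : vertices r c P -> ~ opt_vertices C r c P -> B P.
  move=> PV PO; split; first exact: PV.1.
  by have := vertex_gap_le VO PV PO; rewrite E lee_fin /=; lra.
have Jconv := join_convex (@conv_hull_convex _ _ (opt_vertices C r c)) Bconv.
suff VJ : vertices r c `<=` [set P | exists X Z mu,
    [/\ opt_face C r c X, B Z, 0 <= mu <= 1 & P = (1 - mu) *: X + mu *: Z]].
  have [X [Z [mu [XF [Zpol Zc] mu01 QE]]]] := polytope_ind Jconv VJ Qpol.
  by exists X, Z, mu; split => //; right; exists d.
move=> P PV.
have [PO|PO] := pselect (opt_vertices C r c P).
- exists P, W, 0; rewrite lexx ler01 subr0 scale1r scale0r addr0; split => //.
    exact: sub_conv_hull.
  exact: VB.
- exists V, P, 1; rewrite lexx ler01 subrr scale1r scale0r add0r; split => //.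
    exact: sub_conv_hull.
  exact: VB.
Qed.

End Optimal.

(** * Counting the support of a vertex *)

(** A homogeneous linear system with fewer equations (indexed by [E]) than
    unknowns (indexed by [S]) has a nonzero solution. *)
Lemma underdetermined_system (F : fieldType) (T U : finType) (S : {set T})
    (E : {set U}) (f : T -> U -> F) : (#|E| < #|S|)%N ->
  exists d : T -> F, [/\ exists t, d t != 0, forall t, t \notin S -> d t = 0
    & forall u, u \in E -> \sum_t d t * f t u = 0].
Proof.
move=> ES; pose M := \matrix_(i < #|S|, j < #|E|) f (enum_val i) (enum_val j).
have : kermx M != 0.
  rewrite -mxrank_eq0 mxrank_ker -lt0n subn_gt0.
  exact: leq_ltn_trans (rank_leq_col M) ES.
move=> /rowV0Pn[v /sub_kermxP vM vn0].
exists (fun t => \sum_(i < #|S|) (enum_val i == t)%:R * v 0 i); split.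
- have [i vi] : exists i, v 0 i != 0.
    by move/matrix0Pn: vn0 => [k [i]]; rewrite ord1; exists i.
  exists (enum_val i); rewrite (bigD1 i)//= eqxx mul1r big1 ?addr0// => j ji.
  by rewrite (inj_eq enum_val_inj) (negPf ji) mul0r.
- move=> t tS; rewrite big1// => i _; case: eqP => [it|]; rewrite ?mul0r//.
  by rewrite -it enum_valP in tS.
- move=> u uE; have := congr1 (fun A : 'rV_ _ => A 0 (enum_rank_in uE u)) vM.
  rewrite !mxE => vMu; rewrite -[RHS]vMu.
  under eq_bigr do rewrite mulr_suml.
  rewrite exchange_big /=; apply: eq_bigr => i _.
  rewrite mxE enum_rankK_in// (bigD1 (enum_val i))//= eqxx mul1r big1 ?addr0//.
  by move=> t it; rewrite eq_sym (negPf it) !mul0r.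
Qed.

(** Zero marginals are one linear equation per row and per column, one of which
    is redundant since the row sums and the column sums have the same total. *)
Lemma zero_marginals_supported (R : realType) n (S : {set 'I_n * 'I_n})
    (A B : {set 'I_n}) p0 :
  p0 \in S -> (forall p, p \in S -> (p.1 \in A) /\ (p.2 \in B)) ->
  (#|A| + #|B| <= #|S|)%N ->
  exists D : 'M[R]_n, [/\ zero_marginals D, D != 0
    & forall i j, (i, j) \notin S -> D i j = 0].
Proof.
move=> p0S SAB ABS.
pose E : {set 'I_n + 'I_n} := finset (fun u : 'I_n + 'I_n =>
  match u with inl k => (k != p0.1) && (k \in A) | inr k => k \in B end).
pose f (p : 'I_n * 'I_n) (u : 'I_n + 'I_n) : R :=
  match u with inl k => (p.1 == k)%:R | inr k => (p.2 == k)%:R end.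
have ES : (#|E| < #|S|)%N.
  apply: leq_trans ABS; rewrite (cardsD1 p0.1 A) (SAB _ p0S).1 add1n addSn ltnS.
  rewrite -sum1_card big_sumType /= -!sum1_card leq_add//.
    by rewrite leq_eqVlt; apply/orP/or_introl/eqP/eq_bigl => k; rewrite !inE.
  by rewrite leq_eqVlt; apply/orP/or_introl/eqP/eq_bigl => k; rewrite !inE.
have [d [[t dt] dS dE]] := underdetermined_system f ES.
have pairE (g : 'I_n * 'I_n -> R) : \sum_p g p = \sum_i \sum_k g (i, k).
  by rewrite pair_bigA; apply: eq_bigr => -[].
have colE j : \sum_i d (i, j) = \sum_p d p * f p (inr j).
  rewrite pairE; apply: eq_bigr => i _.
  rewrite (bigD1 j)//= /f eqxx mulr1 big1 ?addr0// => k kj.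
  by rewrite /= (negPf kj) mulr0.
have rowE i : \sum_j d (i, j) = \sum_p d p * f p (inl i).
  rewrite pairE [RHS](bigD1 i)//= [X in _ = _ + X]big1 ?addr0.
    by apply: eq_bigr => j _; rewrite /f eqxx mulr1.
  by move=> k ki; rewrite big1// => j _; rewrite /f /= (negPf ki) mulr0.
have col0 j : \sum_i d (i, j) = 0.
  have [jB|jB] := boolP (j \in B); first by rewrite colE dE// inE.
  by rewrite big1// => i _; apply: dS; apply: contra jB => /SAB[].
have row0 i : i != p0.1 -> \sum_j d (i, j) = 0.
  move=> ip0; have [iA|iA] := boolP (i \in A); first by rewrite rowE dE// inE ip0.
  by rewrite big1// => j _; apply: dS; apply: contra iA => /SAB[].
exists (\matrix_(i, j) d (i, j)); split.
- split=> [i|j]; last by under eq_bigr do rewrite mxE.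
  under eq_bigr do rewrite mxE.
  have [->|/row0//] := eqVneq i p0.1.
  have : \sum_i \sum_j d (i, j) = 0 by rewrite exchange_big /= big1.
  by rewrite (bigD1 p0.1)//= [X in _ + X]big1 ?addr0// => k /row0.
- apply/matrix0Pn; exists t.1, t.2; rewrite mxE.
  by rewrite -surjective_pairing.
- by move=> i j ijS; rewrite mxE dS.
Qed.

(** The sharp bound is [2 n - 1]. *)
Lemma vertex_norm0_le (R : realType) n (r c : 'cV[R]_n) V : vertices r c V ->
  (norm0 V <= 2 * n)%N.
Proof.
move=> VV; rewrite leqNgt; apply/negP => Vn.
pose S : {set 'I_n * 'I_n} := finset (fun p => V p.1 p.2 != 0).
have SE : #|S| = norm0 V by rewrite norm0E; apply: eq_card => p; rewrite !inE.
have [p0 p0S] : exists p, p \in S.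
  by apply/card_gt0P; rewrite SE; exact: leq_ltn_trans Vn.
have [||D [D0 Dn0 DS]] := @zero_marginals_supported R n S [set: 'I_n]%SET
  [set: 'I_n]%SET _ p0S.
- by move=> p _; rewrite !inE.
- by rewrite SE cardsT card_ord addnn -mul2n ltnW.
apply/negP: Dn0; rewrite negbK; apply/eqP; apply: (vertex_rigid VV) => // i j Vij.
by apply: DS; rewrite inE /= Vij eqxx.
Qed.

(** If no point of [S] is alone in its fiber, the image has at most half as many
    points. *)
Lemma double_fibers (T U : finType) (f : T -> U) (S : {set T}) :
  (forall p, p \in S -> exists2 q, q \in S & f q = f p /\ q != p) ->
  (2 * #|(f @: S)%SET| <= #|S|)%N.
Proof.
move=> fS; rewrite -[leqRHS]sum1_card.
rewrite (partition_big f (mem (f @: S)%SET)) /=; last first.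
  by move=> p pS; exact: imset_f.
rewrite mulnC -sum_nat_const; apply: leq_sum => u /imsetP[p pS ->].
have [q qS [qp qnp]] := fS p pS.
rewrite sum1_card; apply/card_gt1P; exists q, p; split=> //.
- by rewrite unfold_in qS qp eqxx.
- by rewrite unfold_in pS eqxx.
Qed.

(** If one of several nonnegative terms lies strictly between 0 and their sum,
    then so does another one. *)
Lemma other_fractional (R : realType) n (f : 'I_n -> R) s i :
  (forall j, 0 <= f j) -> \sum_j f j = s -> 0 < f i < s ->
  exists2 j, j != i & 0 < f j < s.
Proof.
move=> f0 fs /andP[fi0 fis].
have [j ji fj] : exists2 j, j != i & 0 < f j.
  apply/not_exists2P => H; move: fs fis; rewrite (bigD1 i)//= big1.
    by rewrite addr0 => ->; rewrite ltxx.
  move=> j ji; apply/eqP; rewrite eq_le f0 andbT leNgt; apply/negP => fj.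
  by case: (H j) => /(_ _)//; rewrite ji fj.
exists j => //; rewrite fj -fs (bigD1 i)//= (bigD1 j)//=.
have : 0 <= \sum_(k | (k != i) && (k != j)) f k by exact: sumr_ge0.
by lra.
Qed.

(** Birkhoff-von Neumann, as a count.  Fractional entries come at least twice
    in each row and column that they meet, so they would support a tangent
    direction. *)
Lemma uniform_vertex_norm0 (R : realType) n (V : 'M[R]_n) : (0 < n)%N ->
  vertices (const_mx n%:R^-1) (const_mx n%:R^-1) V -> norm0 V = n.
Proof.
move=> n0 VV; have /polytopeP[Vr Vc V0] := VV.1.
have {}Vr i : \sum_j V i j = n%:R^-1 by rewrite Vr mxE.
have {}Vc j : \sum_i V i j = n%:R^-1 by rewrite Vc mxE.
have nR : 0 < n%:R :> R by rewrite ltr0n.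
have Vle i j : V i j <= n%:R^-1.
  by rewrite -(Vr i) (bigD1 j)//= lerDl; exact: sumr_ge0.
pose S : {set 'I_n * 'I_n} := finset (fun p => 0 < V p.1 p.2 < n%:R^-1).
have S0 p0 : p0 \notin S.
  apply/negP => p0S.
  have AS : (2 * #|(@fst _ _ @: S)%SET| <= #|S|)%N.
    apply: double_fibers => -[i j]; rewrite inE /= => Vij.
    have [k kj Vik] := other_fractional (V0 i) (Vr i) Vij.
    by exists (i, k); [rewrite inE|split=> //; apply: contra kj => /eqP[->]].
  have BS : (2 * #|(@snd _ _ @: S)%SET| <= #|S|)%N.
    apply: double_fibers => -[i j]; rewrite inE /= => Vij.
    have [k ki Vkj] := other_fractional (fun i => V0 i j) (Vc j) Vij.
    by exists (k, j); [rewrite inE|split=> //; apply: contra ki => /eqP[->]].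
  have [||D [D0 Dn0 DS]] := @zero_marginals_supported R n S
    (@fst _ _ @: S)%SET (@snd _ _ @: S)%SET _ p0S.
  - by move=> p pS; split; exact: imset_f.
  - by rewrite -(leq_pmul2l (ltn0Sn 1)) mulnDr [leqRHS]mul2n -addnn leq_add.
  apply/negP: Dn0; rewrite negbK; apply/eqP.
  apply: (vertex_rigid VV) => // i j Vij.
  by apply: DS; rewrite inE /= Vij ltxx.
have V01 i j : V i j = (V i j != 0)%:R / n%:R.
  have := S0 (i, j); rewrite inE /= [0 < _]lt_neqAle V0 andbT eq_sym.
  case: eqP => [->|_] /=; first by rewrite mul0r.
  by rewrite -leNgt mul1r => nV; apply/eqP; rewrite eq_le Vle nV.
have : \sum_i \sum_j V i j = 1.
  under eq_bigr do rewrite Vr.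
  by rewrite sumr_const card_ord -[LHS]mulr_natr mulVf// gt_eqF.
rewrite pair_bigA /=; under eq_bigr do rewrite V01.
rewrite -mulr_suml -natr_sum.
have -> : (\sum_p (V p.1 p.2 != 0%R))%N = norm0 V.
  rewrite norm0E -sum1_card [RHS]big_mkcond; apply: eq_bigr => p _.
  by rewrite inE; case: (_ == _).
move=> /(congr1 ( *%R^~ n%:R)); rewrite divfK ?gt_eqF// mul1r => /eqP.
by rewrite eqr_nat => /eqP.
Qed.

(** * Finitely many hyperplanes form a null set *)

Section NullSets.
Variables (R : realType) (n : nat).
Implicit Types (A : set 'M[R]_n) (a b C D : 'M[R]_n).

(** The volume of the box of all [M] with [a i j <= M i j <= b i j]. *)
Definition box_volume a b : R := \prod_(i < n) \prod_(j < n) (b i j - a i j).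

Lemma box_volume_ge0 a b : (forall i j, a i j <= b i j) -> 0 <= box_volume a b.
Proof.
by move=> ab; apply: prodr_ge0 => i _; apply: prodr_ge0 => j _; rewrite subr_ge0.
Qed.

Lemma lebesgue_null_sub A B : A `<=` B -> lebesgue_null B -> lebesgue_null A.
Proof.
move=> AB nB e /nB[a [b [ab Bc le]]]; exists a, b; split => //.
exact: subset_trans Bc.
Qed.

Lemma lebesgue_null_bigcup (A_ : nat -> set 'M[R]_n) :
  (forall k, lebesgue_null (A_ k)) -> lebesgue_null (\bigcup_k A_ k).
Proof.
move=> nA e e0.
have ek k : 0 < e / (2 ^ k.+1)%:R by rewrite divr_gt0// ltr0n expn_gt0.
have H k : exists ab : (nat -> 'M[R]_n) * (nat -> 'M[R]_n),
  [/\ forall l i j, ab.1 l i j <= ab.2 l i j,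
      A_ k `<=` \bigcup_l [set M | forall i j, ab.1 l i j <= M i j <= ab.2 l i j]
    & (\sum_(0 <= l <oo) (box_volume (ab.1 l) (ab.2 l))%:E
        <= (e / (2 ^ k.+1)%:R)%:E)%E].
  by have [a [b abP]] := nA k _ (ek k); exists (a, b).
have [ab abP] := choice H.
have /card_esym/ppcard_eqP[f] := card_nat2.
have le01 k l i j : (ab k).1 l i j <= (ab k).2 l i j by have [] := abP k.
exists (fun m => (ab (f m).1).1 (f m).2), (fun m => (ab (f m).1).2 (f m).2).
split => //.
- move=> M [k _ AM]; have [_ /(_ _ AM)[l _ Ml] _] := abP k.
  have [m _ fm] : [set f m | m in setT] (k, l).
    exact: surj.
  by exists m => //=; rewrite fm.
- have v0 k l : (0 <= (box_volume ((ab k).1 l) ((ab k).2 l))%:E)%E.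
    by rewrite lee_fin box_volume_ge0.
  rewrite nneseries_esumT; last by move=> m; exact: v0.
  rewrite -(@reindex_esum R _ _ setT setT f
    (fun p => (box_volume ((ab p.1).1 p.2) ((ab p.1).2 p.2))%:E)); last first.
    exact: bij.
  have -> : [set: nat * nat] = setT `*`` (fun=> setT).
    by apply/seteqP; split => // -[].
  rewrite -(@esum_esum _ _ _ setT (fun=> setT)
    (fun k l => (box_volume ((ab k).1 l) ((ab k).2 l))%:E))//.
  rewrite -nneseries_esumT; last by move=> k; exact: esum_ge0.
  apply: le_trans (epsilon_trick0 xpredT (ltW e0)).
  apply: lee_nneseries => k *; first exact: esum_ge0.
  by rewrite -nneseries_esumT//; have [] := abP k.
Qed.

(** Finite covers suffice: they are completed by the degenerate box at [0], whose
    volume vanishes because [0 < n]. *)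
Lemma lebesgue_null_fin A : (0 < n)%N ->
  (forall e : R, 0 < e -> exists (I : finType) (a b : I -> 'M[R]_n),
    [/\ forall k i j, a k i j <= b k i j,
        A `<=` [set M | exists k, forall i j, a k i j <= M i j <= b k i j]
      & \sum_k box_volume (a k) (b k) <= e]) -> lebesgue_null A.
Proof.
move=> n0 H e /H[I [a [b [ab Acov le]]]].
pose s := [seq (a i, b i) | i <- enum I].
exists (fun k => (nth (0, 0) s k).1), (fun k => (nth (0, 0) s k).2).
have ss k : (k < size s)%N -> exists i, nth (0, 0) s k = (a i, b i).
  move=> ks; have /mapP[i _ ->] : nth (0, 0) s k \in s by exact: mem_nth.
  by exists i.
have s_le k i j : (nth (0, 0) s k).1 i j <= (nth (0, 0) s k).2 i j.
  have [ks|sk] := ltnP k (size s); last by rewrite nth_default//= lexx.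
  by have [l ->] := ss k ks; exact: ab.
split => //.
- move=> M /Acov[k Mk]; exists (index (a k, b k) s) => //=.
  by rewrite nth_index//; apply: map_f; rewrite mem_enum.
- apply: lime_le.
    by apply: is_cvg_nneseries => k _ _; rewrite lee_fin box_volume_ge0.
  exists (size s) => // T /= sT.
  rewrite (big_cat_nat (leq0n _) sT)//= [X in (_ + X)%E]big_nat_cond.
  rewrite [X in (_ + X)%E]big1 ?adde0; last first.
    move=> k /andP[/andP[sk _] _]; rewrite nth_default//.
    rewrite (bigD1 (Ordinal n0))//= (bigD1 (Ordinal n0))//=.
    by rewrite subrr !mul0r.
  rewrite sumEFin lee_fin; apply: le_trans le.
  rewrite -(big_nth (0, 0) xpredT (fun p => box_volume p.1 p.2)) big_map.
  by rewrite big_enum.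
Qed.

(** Solve the equation for one coordinate [p0], and cut the others into [m] pieces
    each.  The boxes over the cells have height of order [1/m], and so has their
    total volume.  Cells are indexed by functions on all coordinates, so that the
    total volume is a product of sums; those with a nonzero index at [p0] get
    height 0. *)
Lemma hyperplane_null D : D != 0 -> lebesgue_null [set C | cost C D = 0].
Proof.
move=> /matrix0Pn[i0 [j0 D0]]; set p0 := (i0, j0).
have n0 : (0 < n)%N by apply: leq_ltn_trans (ltn_ord i0).
pose bounded K :=
  [set C : 'M[R]_n | (forall i j, `|C i j| <= K%:R) /\ cost C D = 0].
apply: (@lebesgue_null_sub _ (\bigcup_K bounded K)).
  move=> C /= CD; pose K := \sum_i \sum_j `|C i j|.
  exists (Num.truncn K).+1 => //=; split => // i j.
  have K0 : 0 <= K by apply: sumr_ge0 => k _; exact: sumr_ge0.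
  apply: (@le_trans _ _ K); last by have /andP[_ /ltW] := truncn_itv K0.
  rewrite /K (bigD1 i)//= (bigD1 j)//= -addrA lerDl addr_ge0//.
    exact: sumr_ge0.
  by apply: sumr_ge0 => k _; exact: sumr_ge0.
apply: lebesgue_null_bigcup => K; apply: lebesgue_null_fin => // e e0.
pose M : R := K.+1%:R; have M0 : 0 < M by rewrite ltr0n.
pose d (p : 'I_n * 'I_n) := D p.1 p.2; have d0 : d p0 != 0 by [].
(* On a cell of width w in the other coordinates, the coordinate p0 of a point
   of the hyperplane varies by at most L * w. *)
pose L : R := \sum_p `|d p| / `|d p0|.
have L0 : 0 <= L by apply: sumr_ge0 => p _; rewrite divr_ge0.
pose W : R := \prod_(p : 'I_n * 'I_n | p != p0) (2 * M).
have W0 : 0 <= W by apply: prodr_ge0 => p _; rewrite mulr_ge0// ltW.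
pose x := W * (4 * L * M) / e.
have x0 : 0 <= x by rewrite divr_ge0 ?mulr_ge0// ltW.
pose m := Num.truncn x; pose w : R := 2 * M / m.+1%:R.
have m0 : 0 < m.+1%:R :> R by rewrite ltr0n.
have w0 : 0 < w by rewrite divr_gt0 ?mulr_gt0.
pose I := {ffun 'I_n * 'I_n -> 'I_m.+1}.
pose lo (g : I) p : R := - M + (g p)%:R * w.
pose z (g : I) : R := - (\sum_(p | p != p0) lo g p * d p) / d p0.
pose width p (k : 'I_m.+1) : R :=
  if p == p0 then (if k == ord0 then 2 * L * w else 0) else w.
pose a (g : I) : 'M[R]_n := \matrix_(i, j)
  if (i, j) == p0 then z g - L * w else lo g (i, j).
pose b (g : I) : 'M[R]_n := \matrix_(i, j) (a g i j + width (i, j) (g (i, j))).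
have width0 p k : 0 <= width p k.
  rewrite /width; case: ifP => _; last exact: ltW.
  by case: ifP => // _; rewrite !mulr_ge0// ltW.
exists I, a, b; split.
- by move=> g i j; rewrite [leRHS]mxE lerDl.
- move=> C [CK CD] /=.
  pose t p := (C p.1 p.2 + M) / w.
  have CM p : - M <= C p.1 p.2 < M.
    have := CK p.1 p.2; rewrite ler_norml => /andP[lo_ hi].
    have KM : K%:R < M by rewrite ltr_nat.
    by rewrite (le_lt_trans hi KM) andbT (le_trans _ lo_)// lerN2 ltW.
  have t0 p : 0 <= t p.
    by have /andP[h _] := CM p; rewrite divr_ge0 ?(ltW w0)//; lra.
  have tm p : (Num.truncn (t p) < m.+1)%N.
    have /andP[h1 h2] := truncn_itv (t0 p).
    rewrite -(@ltr_nat R); apply: le_lt_trans h1 _.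
    rewrite ltr_pdivrMr// /w mulrCA divff ?gt_eqF// mulr1.
    by have /andP[_] := CM p; lra.
  pose g : I := [ffun p => if p == p0 then ord0 else Ordinal (tm p)].
  have Clo p : p != p0 -> lo g p <= C p.1 p.2 <= lo g p + w.
    move=> pp0; rewrite /lo ffunE (negPf pp0) /=.
    have /andP[] := truncn_itv (t0 p).
    rewrite {2 3}/t ler_pdivlMr// ltr_pdivrMr// -[X in _ < X * _]natr1.
    by move=> h1 h2; apply/andP; split; lra.
  exists g => i j; rewrite [b g i j]mxE /width.
  rewrite ![a g i j]mxE; case: (eqVneq (i, j) p0) => [ijp0|]; last first.
    by move=> ijp; have := Clo _ ijp.
  rewrite ijp0 ffunE !eqxx.
  have -> : C i j = - (\sum_(p | p != p0) C p.1 p.2 * d p) / d p0.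
    apply: (canRL (mulfK d0)); apply/eqP; rewrite -addr_eq0; apply/eqP.
    rewrite -[RHS]CD /cost pair_bigA /= [RHS](bigD1 p0)//=.
    by case: ijp0 => -> ->.
  have : `| \sum_(p | p != p0) (C p.1 p.2 - lo g p) * d p / d p0| <= L * w.
    apply: le_trans (ler_norm_sum _ _ _) _; rewrite /L mulr_suml.
    rewrite [leRHS](bigID (fun p => p != p0))/=.
    rewrite -[leLHS]addr0 lerD//; last first.
      by apply: sumr_ge0 => p _; apply: mulr_ge0; [exact: divr_ge0|exact: ltW].
    apply: ler_sum => p /Clo/andP[h1 h2].
    rewrite !normrM normfV -mulrA mulrC ler_wpM2l ?divr_ge0//.
    by rewrite ger0_norm; lra.
  rewrite -mulr_suml.
  have -> : \sum_(p | p != p0) (C p.1 p.2 - lo g p) * d p =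
    \sum_(p | p != p0) C p.1 p.2 * d p - \sum_(p | p != p0) lo g p * d p.
    by rewrite -sumrB; apply: eq_bigr => p _; rewrite mulrBl.
  rewrite ler_norml mulrBl /z !mulNr => /andP[h1 h2].
  by apply/andP; split; lra.
- (* The sum over all cells of the products of the widths factors. *)
  have volE g : box_volume (a g) (b g) = \prod_p width p (g p).
    rewrite /box_volume pair_bigA; apply: eq_bigr => -[i j] _ /=.
    by rewrite [b g i j]mxE addrAC subrr add0r.
  under eq_bigr do rewrite volE.
  rewrite -(bigA_distr_bigA width) (bigD1 p0)//=.
  have -> : \sum_k width p0 k = 2 * L * w.
    rewrite (bigD1 ord0)//= big1 ?addr0 /width ?eqxx//.
    by move=> k /negPf->.
  have -> : \prod_(p | p != p0) \sum_k width p k = W.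
    apply: eq_bigr => p pp0; rewrite /width (negPf pp0) sumr_const card_ord.
    by rewrite -[LHS]mulr_natr divfK// gt_eqF.
  have /andP[_ xm] := truncn_itv x0.
  rewrite /w; move: xm; rewrite ltr_pdivrMr// -/m => xm.
  rewrite mulrC !mulrA ler_pdivrMr// [e * _]mulrC.
  apply: ltW; apply: le_lt_trans xm.
  by rewrite le_eqVlt; apply/orP; left; apply/eqP; ring.
Qed.

End NullSets.

(** * The entropic penalty argument *)

Section Entropy.
Variable R : realType.
Implicit Types (a b p q s u v mu : R).

Lemma ln_le_sub1 u : 0 < u -> ln u <= u - 1.
Proof.
move=> u0; have -> : u = 1 + (u - 1) by rewrite addrC subrK.
by rewrite [X in _ <= X - _]addrC subrK le_ln1Dx// ltrBrDr addNr.
Qed.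

(** A term [a * ln (a / p)] of the relative entropy lies between its linear and
    chi-square estimates, with the convention [0 * ln 0 = 0]. *)
Lemma kl_term_ge a p : 0 <= a -> 0 < p -> a - p <= a * ln a - a * ln p.
Proof.
move=> a0 p0; have [->|an0] := eqVneq a 0; first by rewrite !mul0r; lra.
have a1 : 0 < a by rewrite lt_neqAle eq_sym an0.
have := ln_le_sub1 (divr_gt0 p0 a1); rewrite ln_div ?posrE// => h.
have : a * (ln p - ln a) <= a * (p / a - 1) by rewrite ler_wpM2l.
rewrite mulrBr mulrBr mulr1 [a * (p / a)]mulrC divfK//; lra.
Qed.

Lemma kl_term_le a p : 0 <= a -> 0 < p ->
  a * ln a - a * ln p <= (a - p) ^+ 2 / p + (a - p).
Proof.
move=> a0 p0; have [->|an0] := eqVneq a 0.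
  by rewrite !mul0r !sub0r sqrrN expr2 mulfK ?gt_eqF// subrr.
have a1 : 0 < a by rewrite lt_neqAle eq_sym an0.
have := ln_le_sub1 (divr_gt0 a1 p0); rewrite ln_div ?posrE// => h.
have : a * (ln a - ln p) <= a * (a / p - 1) by rewrite ler_wpM2l.
have -> : a * (a / p - 1) = (a - p) ^+ 2 / p + (a - p).
  by field; rewrite gt_eqF.
by rewrite mulrBr.
Qed.

Lemma xlnx_superadditive u v : 0 <= u -> 0 <= v ->
  u * ln u + v * ln v <= (u + v) * ln (u + v).
Proof.
move=> u0 v0; have [->|un0] := eqVneq u 0; first by rewrite mul0r !add0r.
have [->|vn0] := eqVneq v 0; first by rewrite mul0r !addr0.
have u1 : 0 < u by rewrite lt_neqAle eq_sym un0.
have v1 : 0 < v by rewrite lt_neqAle eq_sym vn0.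
rewrite mulrDl lerD// ler_wpM2l// ler_ln ?posrE ?addr_gt0//.
  by rewrite lerDl.
by rewrite lerDr.
Qed.

Lemma xlnxM s u : 0 <= s -> 0 <= u ->
  (s * u) * ln (s * u) = s * (u * ln u) + s * ln s * u.
Proof.
move=> s0 u0; have [->|un0] := eqVneq u 0.
  by rewrite !mulr0 !mul0r mulr0 addr0.
have [->|sn0] := eqVneq s 0; first by rewrite !mul0r addr0.
have u1 : 0 < u by rewrite lt_neqAle eq_sym un0.
have s1 : 0 < s by rewrite lt_neqAle eq_sym sn0.
by rewrite lnM ?posrE//; ring.
Qed.

Lemma xlnx_onem_ge mu : mu <= 1 -> - mu <= (1 - mu) * ln (1 - mu).
Proof.
move=> mu1; have := @kl_term_ge (1 - mu) 1; rewrite ln1 subr_ge0 mulr0 subr0.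
by move=> /(_ mu1 ltr01); lra.
Qed.

(** If [Q] is a mixture of [X] and [Z] with weight [mu] on [Z], the entropy
    gained by mixing is at most [mu * (ln #|T| + 1 - ln mu)].  Hence a linear
    loss [mu * g] can be compensated only if [mu] is about [exp (- g)], up to
    the defect of optimality of [Q], measured by its chi-square distance to [P]. *)
Lemma entropic_mixture (T : finType) (P Q X Z : T -> R) mu g :
  (forall t, 0 < P t) -> (forall t, 0 <= X t) -> (forall t, 0 <= Z t) ->
  \sum_t P t = 1 -> \sum_t X t = 1 -> \sum_t Z t = 1 -> 0 <= mu <= 1 ->
  (forall t, Q t = (1 - mu) * X t + mu * Z t) ->
  mu * g <= \sum_t (X t - Q t) * ln (P t) ->
  mu <= expR (1 + ln #|T|%:R - g) + \sum_t (Q t - P t) ^+ 2 / P t.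
Proof.
move=> P0 X0 Z0 P1 X1 Z1 /andP[mu0 mu1] QE.
have mu1' : 0 <= 1 - mu by rewrite subr_ge0.
have Q0 t : 0 <= Q t by rewrite QE addr_ge0// mulr_ge0.
have Q1 : \sum_t Q t = 1.
  under eq_bigr do rewrite QE.
  by rewrite big_split /= -!mulr_sumr X1 Z1 !mulr1 subrK.
have T0 : 0 < #|T|%:R :> R.
  rewrite ltr0n lt0n; apply/eqP => T0; move: P1; rewrite big_pred0.
    by move/eqP; rewrite eq_sym oner_eq0.
  by move=> t; have := fintype0 t T0.
set delta := \sum_t (Q t - P t) ^+ 2 / P t.
under eq_bigr do rewrite mulrBl.
rewrite sumrB => gap.
have KLX : \sum_t X t * ln (P t) <= \sum_t X t * ln (X t).
  rewrite -subr_ge0 -sumrB.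
  apply: (@le_trans _ _ (\sum_t (X t - P t))); first by rewrite sumrB X1 P1 subrr.
  by apply: ler_sum => t _; exact: kl_term_ge.
have KLQ : \sum_t Q t * ln (Q t) - \sum_t Q t * ln (P t) <= delta.
  rewrite -sumrB.
  apply: (@le_trans _ _ (\sum_t ((Q t - P t) ^+ 2 / P t + (Q t - P t)))).
    by apply: ler_sum => t _; exact: kl_term_le.
  by rewrite big_split /= sumrB Q1 P1 subrr addr0.
have HX : \sum_t X t * ln (X t) <= 0.
  apply: sumr_le0 => t _; rewrite mulr_ge0_le0// ln_le0//.
  by rewrite -X1 (bigD1 t)//= lerDl sumr_ge0.
have HZ : - ln #|T|%:R <= \sum_t Z t * ln (Z t).
  have : \sum_t (Z t - #|T|%:R^-1) <=
      \sum_t (Z t * ln (Z t) - Z t * ln #|T|%:R^-1).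
    by apply: ler_sum => t _; rewrite kl_term_ge// invr_gt0.
  rewrite !sumrB -mulr_suml Z1 sumr_const -[_ *+ _]mulr_natr mulVf ?gt_eqF//.
  by rewrite lnV ?posrE//; lra.
have HQ : (1 - mu) * \sum_t X t * ln (X t) + mu * \sum_t Z t * ln (Z t)
    + (1 - mu) * ln (1 - mu) + mu * ln mu <= \sum_t Q t * ln (Q t).
  have -> : (1 - mu) * \sum_t X t * ln (X t) + mu * \sum_t Z t * ln (Z t)
    + (1 - mu) * ln (1 - mu) + mu * ln mu =
    \sum_t (((1 - mu) * X t) * ln ((1 - mu) * X t)
            + (mu * Z t) * ln (mu * Z t)).
    under [RHS]eq_bigr do rewrite !xlnxM//.
    rewrite !big_split /= -!mulr_sumr X1 Z1; ring.
  apply: ler_sum => t _; rewrite QE; apply: xlnx_superadditive;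
    exact: mulr_ge0.
have := xlnx_onem_ge mu1; have := kl_term_ge mu0 (expR_gt0 (1 + ln #|T|%:R - g)).
rewrite expRK.
have : mu * (\sum_t X t * ln (X t)) <= 0 by rewrite mulr_ge0_le0.
have : mu * (- ln #|T|%:R) <= mu * \sum_t Z t * ln (Z t) by rewrite ler_wpM2l.
by rewrite !mulrDr mulrN mulr1; lra.
Qed.

End Entropy.

Lemma expR1_le3 (R : realType) : expR 1 <= 3 :> R.
Proof.
(* exp (-1/6) >= 5/6 and (6/5)^6 < 3 *)
have h : 5 / 6 <= expR (- 6^-1) :> R by have := expR_ge1Dx (- 6^-1 : R); lra.
have u : expR (6^-1) <= 6 / 5 :> R.
  rewrite -[6^-1]opprK expRN invf_ple ?posrE ?expR_gt0 ?divr_gt0//.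
  by rewrite invf_div.
have le3 : (6 / 5) ^+ 6 <= 3 :> R by rewrite !exprS expr0; lra.
have -> : expR 1 = expR (6^-1) ^+ 6 :> R by rewrite -expRM_natl divff.
apply: le_trans le3.
by apply: lerXn2r => //; rewrite nnegrE ?expR_ge0// divr_ge0.
Qed.

Section FaceDistance.
Variables (R : realType) (n : nat) (r c : 'cV[R]_n).
Hypotheses (r_gt0 : forall i, 0 < r i 0) (c_gt0 : forall i, 0 < c i 0).
Hypotheses (r_sum1 : norm1 r = 1) (c_sum1 : norm1 c = 1).
Implicit Types (C P Q V X Z : 'M[R]_n) (x y : 'cV[R]_n).

Lemma norm1E m k (M : 'M[R]_(m, k)) : norm1 M = \sum_p `|M p.1 p.2|.
Proof. by rewrite /norm1 pair_bigA. Qed.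

Lemma norm1_ge0 m k (M : 'M[R]_(m, k)) : 0 <= norm1 M.
Proof. by rewrite norm1E sumr_ge0. Qed.

Lemma norm1D m k (M N : 'M[R]_(m, k)) : norm1 (M + N) <= norm1 M + norm1 N.
Proof.
rewrite !norm1E -big_split; apply: ler_sum => p _ /=.
by rewrite mxE; exact: ler_normD.
Qed.

Lemma norm1Z m k a (M : 'M[R]_(m, k)) : norm1 (a *: M) = `|a| * norm1 M.
Proof.
by rewrite !norm1E mulr_sumr; apply: eq_bigr => p _; rewrite mxE normrM.
Qed.

Lemma norm1B_le2 m k (M N : 'M[R]_(m, k)) : norm1 M = 1 -> norm1 N = 1 ->
  norm1 (M - N) <= 2.
Proof.
move=> M1 N1; apply: le_trans (norm1D _ _) _.
by rewrite -scaleN1r norm1Z M1 N1 normrN normr1; lra.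
Qed.

Lemma polytope_total P : polytope r c P -> \sum_p P p.1 p.2 = 1.
Proof.
move=> /polytopeP[Pr _ _]; rewrite -(pair_bigA _ (fun i j => P i j)) /=.
by under eq_bigr do rewrite Pr; exact: sum_r.
Qed.

Lemma polytope_norm1 P : polytope r c P -> norm1 P = 1.
Proof.
move=> Ppol; rewrite -(polytope_total Ppol) norm1E; apply: eq_bigr => p _.
by have /polytopeP[_ _ P0] := Ppol; rewrite ger0_norm.
Qed.

Lemma plan_gt0 C eta x y i j : 0 < plan C eta x y i j.
Proof. by rewrite mxE expR_gt0. Qed.

(** The dual variables of a Gibbs plan pair to zero with tangent directions, so
    along the polytope its logarithm is the cost up to the factor [- eta]. *)
Lemma ln_plan_gap C eta x y X Q : polytope r c X -> polytope r c Q ->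
  \sum_p (X p.1 p.2 - Q p.1 p.2) * ln (plan C eta x y p.1 p.2) =
  eta * (cost C Q - cost C X).
Proof.
move=> Xpol Qpol; have [Dr Dc] := zero_marginalsB Xpol Qpol.
rewrite -(pair_bigA _ (fun i j => (X i j - Q i j) * ln (plan C eta x y i j))) /=.
transitivity (\sum_i \sum_j (eta * (C i j * Q i j - C i j * X i j)
   + (X - Q) i j * (eta * x i 0 - 1) + (X - Q) i j * (eta * y j 0))).
  apply: eq_bigr => i _; apply: eq_bigr => j _.
  by rewrite !mxE expRK; ring.
under eq_bigr do rewrite !big_split /= -mulr_suml Dr mul0r addr0.
rewrite big_split /= [X in _ + X]exchange_big /= [X in _ + X]big1 ?addr0.
  rewrite /cost -sumrB mulr_sumr; apply: eq_bigr => i _.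
  by rewrite -mulr_sumr sumrB.
by move=> j _; rewrite -mulr_suml Dc mul0r.
Qed.

(** The factor 6 bounds [2 * expR 1]. *)
Lemma plan_polytope_near_face C eta x y Q : 0 < eta ->
  let P := plan C eta x y in
  \sum_p P p.1 p.2 = 1 -> polytope r c Q ->
  exists2 X, opt_face C r c X & norm1 (X - Q) <=
    6 * n%:R ^+ 2 * fine (expeR (- (eta%:E * vertex_gap C r c))%E)
    + 2 * \sum_p (Q p.1 p.2 - P p.1 p.2) ^+ 2 / P p.1 p.2.
Proof.
move=> eta0 P P1 Qpol.
have [V VO] := opt_vertices_neq0 r_gt0 c_gt0 r_sum1 c_sum1 C.
have [X [Z [mu [XF Zpol mu01 QE gap]]]] :=
  face_split r_gt0 c_gt0 r_sum1 c_sum1 VO Qpol.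
have /andP[mu0 mu1] := mu01.
have [Xpol Xmin] := opt_face_solution XF.
have /polytopeP[_ _ X0] := Xpol; have /polytopeP[_ _ Z0] := Zpol.
have P0 i j : 0 < P i j by exact: plan_gt0.
exists X => //.
have d0 : 0 <= \sum_p (Q p.1 p.2 - P p.1 p.2) ^+ 2 / P p.1 p.2.
  by apply: sumr_ge0 => p _; rewrite divr_ge0 ?sqr_ge0// ltW.
have -> : X - Q = mu *: (X - Z).
  by rewrite QE scalerBl scale1r opprD opprB addrA addrCA subrr addr0 scalerBr.
rewrite norm1Z ger0_norm//.
have XZ : norm1 (X - Z) <= 2 by apply: norm1B_le2; exact: polytope_norm1.
apply: (@le_trans _ _ (2 * mu)); first by rewrite mulrC ler_wpM2r.
case: gap => [->|[d -> dZ]].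
  by rewrite mulr0 addr_ge0 ?mulr_ge0 ?fine_ge0 ?expeR_ge0.
rewrite -EFinM -EFinN /=.
have := @entropic_mixture R ('I_n * 'I_n)%type (fun p => P p.1 p.2)
  (fun p => Q p.1 p.2) (fun p => X p.1 p.2) (fun p => Z p.1 p.2) mu (eta * d).
move=> /(_ _ _ _ P1 (polytope_total Xpol) (polytope_total Zpol) mu01).
move=> /(_ (fun p => P0 _ _) (fun p => X0 _ _) (fun p => Z0 _ _)).
have QE' p : Q p.1 p.2 = (1 - mu) * X p.1 p.2 + mu * Z p.1 p.2.
  by rewrite QE !mxE.
have gapE : mu * (eta * d) <=
    \sum_p (X p.1 p.2 - Q p.1 p.2) * ln (P p.1 p.2).
  rewrite ln_plan_gap// mulrCA ler_wpM2l ?(ltW eta0)//.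
  rewrite QE costD !costZ.
  have : cost C X <= cost C V by exact: (Xmin _ VO.1.1).
  have : mu * (cost C V + d) <= mu * cost C Z by rewrite ler_wpM2l.
  move=> h1 h2; have : mu * cost C X <= mu * cost C V by rewrite ler_wpM2l.
  by lra.
move=> /(_ QE' gapE) muB.
have n0 : (0 < n)%N.
  rewrite lt0n; apply/eqP => nE; move: P1; rewrite big_pred0.
    by move/eqP; rewrite eq_sym oner_eq0.
  by move=> [i _]; have := ltn_ord i; rewrite {2}nE.
have : expR (1 + ln #|{: 'I_n * 'I_n}|%:R - eta * d) <=
    3 * n%:R ^+ 2 * expR (- (eta * d)).
  rewrite !expRD ler_wpM2r ?expR_ge0// card_prod card_ord lnK ?posrE.
    by rewrite natrM -expr2 ler_wpM2r ?sqr_ge0// expR1_le3.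
  by rewrite ltr0n muln_gt0 n0.
by move: muB; lra.
Qed.

(** A Gibbs plan with column marginals [c] is close to the optimal face as soon
    as its row marginals are close to [r]: correct its row sums by the rank one
    matrix [(r - P 1) c^T], or, if that fails to be nonnegative, use that any two
    plans are at distance at most [2]. *)
Lemma plan_near_face C eta x y p0 : 0 < eta -> 0 < p0 ->
  let P := plan C eta x y in
  let e := \sum_i `|r i 0 - \sum_j P i j| in
  (forall j, \sum_i P i j = c j 0) -> (forall i j, p0 <= P i j) ->
  exists2 X, opt_face C r c X & norm1 (X - P) <=
    6 * n%:R ^+ 2 * fine (expeR (- (eta%:E * vertex_gap C r c))%E)
    + (3 + 2 / p0) * e.
Proof.
move=> eta0 p0_gt0 P e Pc Pp0.
have e0 : 0 <= e by exact: sumr_ge0.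
have P0 i j : 0 < P i j by exact: lt_le_trans (Pp0 i j).
have B0 : 0 <= 6 * n%:R ^+ 2 *
    fine (expeR (- (eta%:E * vertex_gap C r c))%E) :> R.
  by rewrite mulr_ge0 ?fine_ge0 ?expeR_ge0// mulr_ge0.
have P1 : \sum_p P p.1 p.2 = 1.
  rewrite -(pair_bigA _ (fun i j => P i j)) exchange_big /=.
  by under eq_bigr do rewrite Pc; exact: sum_c.
have P1n : norm1 P = 1.
  by rewrite norm1E -P1; apply: eq_bigr => p _; rewrite gtr0_norm.
pose d i := r i 0 - \sum_j P i j.
have [ep|pe] := leP e p0; last first.
  have [V VO] := opt_vertices_neq0 r_gt0 c_gt0 r_sum1 c_sum1 C.
  exists V; first exact: sub_conv_hull.
  apply: le_trans (norm1B_le2 (polytope_norm1 VO.1.1) P1n) _.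
  have : 2 <= 2 / p0 * e by rewrite mulrAC ler_pdivlMr// ler_wpM2l// ltW.
  by rewrite mulrDl; lra.
have de i : `|d i| <= e by rewrite /e (bigD1 i)//= lerDl sumr_ge0.
have c1 j : c j 0 <= 1.
  rewrite -(sum_c c_gt0 c_sum1) (bigD1 j)//= lerDl sumr_ge0// => k _.
  exact: ltW.
pose Q : 'M[R]_n := \matrix_(i, j) (P i j + d i * c j 0).
have Qpol : polytope r c Q.
  apply/polytopeP; split => [i|j|i j].
  - under eq_bigr do rewrite mxE.
    by rewrite big_split /= -mulr_sumr sum_c// mulr1 addrC subrK.
  - under eq_bigr do rewrite mxE.
    rewrite big_split /= -mulr_suml Pc sumrB (sum_r r_gt0 r_sum1).
    by rewrite (pair_bigA _ (fun i j => P i j)) P1 subrr mul0r addr0.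
  - have : `|d i * c j 0| <= P i j.
      rewrite normrM (gtr0_norm (c_gt0 j)).
      apply: (@le_trans _ _ (e * 1)); first by rewrite ler_pM// ltW.
      by rewrite mulr1 (le_trans ep).
    by rewrite ler_norml [Q i j]mxE => /andP[]; lra.
have [X XF XQ] := plan_polytope_near_face eta0 P1 Qpol.
exists X => //.
have QP : norm1 (Q - P) = e.
  apply: eq_bigr => i _; rewrite -[RHS]mulr1 -(sum_c c_gt0 c_sum1) mulr_sumr.
  apply: eq_bigr => j _; rewrite !mxE addrAC subrr add0r normrM.
  by rewrite (gtr0_norm (c_gt0 j)).
have chi2 : \sum_p (Q p.1 p.2 - P p.1 p.2) ^+ 2 / P p.1 p.2 <= e.
  rewrite -[leRHS]QP norm1E; apply: ler_sum => -[i j] _ /=.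
  rewrite !mxE addrAC subrr add0r ler_pdivrMr; last by have := P0 i j; rewrite mxE.
  rewrite -real_normK ?num_real// expr2 ler_wpM2l//.
  rewrite normrM (gtr0_norm (c_gt0 j)); have := Pp0 i j; rewrite mxE => Pij.
  apply: (@le_trans _ _ (e * 1)); first by rewrite ler_pM// ltW.
  by rewrite mulr1 (le_trans ep).
have -> : X - P = (X - Q) + (Q - P) by rewrite addrA subrK.
apply: le_trans (norm1D _ _) _; rewrite QP.
have : 0 <= 2 / p0 * e by rewrite mulr_ge0// divr_ge0// ltW.
by rewrite mulrDl; lra.
Qed.

End FaceDistance.

(** * Convergence of Sinkhorn scaling *)

Section Scaling.
Variables (R : realType) (n : nat) (r c : 'cV[R]_n).
Hypotheses (r_gt0 : forall i, 0 < r i 0) (c_gt0 : forall i, 0 < c i 0).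
Hypotheses (r_sum1 : norm1 r = 1) (c_sum1 : norm1 c = 1).
Implicit Types (C P : 'M[R]_n) (x y : 'cV[R]_n).

(** A nonnegative matrix whose rows sum to [m] acts on row vectors with l1 norm at
    most [m]. *)
Lemma stochastic_l1_le (w : 'I_n -> 'I_n -> R) (d : 'I_n -> R) (m : R) :
  (forall i j, 0 <= w i j) -> (forall i, \sum_j w i j = m) ->
  \sum_j `|\sum_i w i j * d i| <= m * \sum_i `|d i|.
Proof.
move=> w0 w1; rewrite mulr_sumr.
apply: (@le_trans _ _ (\sum_j \sum_i w i j * `|d i|)).
  apply: ler_sum => j _; apply: le_trans (ler_norm_sum _ _ _) _.
  by apply: ler_sum => i _; rewrite normrM ger0_norm.
rewrite exchange_big /=; apply: ler_sum => i _.
by rewrite -mulr_suml w1.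
Qed.

(** One full Sinkhorn step contracts the error of the row marginals: the column
    error is the image of the row error, which has total zero, by a stochastic
    matrix with entries at least [p0] (Doeblin), and the second half step does
    not increase the error. *)
Lemma scaling_contraction P p0 (s c' : 'I_n -> R) : 0 <= p0 ->
  (forall i j, p0 <= P i j) -> (forall i j, 0 < P i j) ->
  (forall j, \sum_i P i j = c j 0) -> (forall i, s i = \sum_j P i j) ->
  (forall j, c' j = \sum_i P i j * (r i 0 / s i)) ->
  \sum_i `|r i 0 - \sum_j P i j * (r i 0 / s i) * (c j 0 / c' j)| <=
  (1 - p0) * \sum_i `|r i 0 - s i|.
Proof.
move=> p0_ge0 Pp0 P0 Pc sE c'E; pose d i := r i 0 - s i.
have [i0 _|n0] := pickP 'I_n; last first.
  by rewrite !big_pred0 ?mulr0// => i; have := n0 i.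
have sum_s : \sum_i s i = 1.
  under eq_bigr do rewrite sE.
  rewrite exchange_big /=; under eq_bigr do rewrite Pc.
  exact: sum_c.
have s0 i : 0 < s i.
  rewrite sE; apply: lt_le_trans (P0 i i0) _.
  by rewrite (bigD1 i0)//= lerDl sumr_ge0// => j _; exact: ltW.
have s1 i : s i <= 1.
  by rewrite -sum_s (bigD1 i)//= lerDl sumr_ge0// => j _; exact: ltW.
have sum_d : \sum_i d i = 0 by rewrite sumrB sum_s (sum_r r_gt0 r_sum1) subrr.
have P'0 i j : 0 < P i j * (r i 0 / s i) by rewrite mulr_gt0 ?divr_gt0.
have c'0 j : 0 < c' j.
  rewrite c'E; apply: lt_le_trans (P'0 i0 j) _.
  by rewrite (bigD1 i0)//= lerDl sumr_ge0// => i _; exact: ltW.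
have P'r i : \sum_j P i j * (r i 0 / s i) = r i 0.
  by rewrite -mulr_suml -sE mulrC divfK// gt_eqF.
apply: (@le_trans _ _ (\sum_j `|c j 0 - c' j|)).
  rewrite -[leRHS]mul1r.
  under eq_bigr => i _.
    have -> : r i 0 - \sum_j P i j * (r i 0 / s i) * (c j 0 / c' j) =
       - \sum_j (P i j * (r i 0 / s i) / c' j) * (c j 0 - c' j).
      rewrite -{1}(P'r i) -sumrB -sumrN; apply: eq_bigr => j _.
      by field; rewrite !gt_eqF.
    rewrite normrN; over.
  apply: (@stochastic_l1_le (fun j i => P i j * (r i 0 / s i) / c' j)).
    by move=> j i; rewrite divr_ge0// ltW.
  by move=> j; rewrite -mulr_suml -c'E divff// gt_eqF.
under eq_bigr => j _.
  have -> : c j 0 - c' j = - \sum_i (P i j / s i - p0) * d i.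
    have -> : \sum_i (P i j / s i - p0) * d i = \sum_i P i j / s i * d i.
      transitivity (\sum_i P i j / s i * d i - p0 * \sum_i d i).
        rewrite mulr_sumr -sumrB; apply: eq_bigr => i _; exact: mulrBl.
      by rewrite sum_d mulr0 subr0.
    rewrite -(Pc j) c'E -sumrB -sumrN.
    by apply: eq_bigr => i _; rewrite /d; field; rewrite gt_eqF.
  rewrite normrN; over.
apply: (@le_trans _ _ ((1 - n%:R * p0) * \sum_i `|d i|)).
  apply: (@stochastic_l1_le (fun i j => P i j / s i - p0)).
    move=> i j; rewrite subr_ge0 ler_pdivlMr// (le_trans _ (Pp0 i j))//.
    by rewrite ler_piMr.
  move=> i; rewrite sumrB -mulr_suml -sE divff ?gt_eqF//.
  by rewrite sumr_const card_ord -[_ *+ _]mulr_natl.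
rewrite ler_wpM2r ?sumr_ge0// lerB// ler_peMl// ler1n.
exact: leq_ltn_trans (ltn_ord i0).
Qed.

Lemma plan_update_x C eta x y i j : eta != 0 ->
  plan C eta (update_x C r eta x y) y i j =
  plan C eta x y i j * (r i 0 / \sum_k plan C eta x y i k).
Proof.
move=> eta0; set s := \sum_k _.
have s0 : 0 < s.
  rewrite /s (bigD1 i)//= ltr_pwDl ?plan_gt0// sumr_ge0// => k _.
  by rewrite ltW ?plan_gt0.
rewrite mxE [X in _ = X * _]mxE /update_x !mxE.
under eq_bigr do rewrite [ones _ _ _ _]mxE mulr1.
rewrite -/s -ln_div ?posrE// -[X in _ = _ * X]lnK ?posrE ?divr_gt0// -expRD.
by congr expR; field.
Qed.

Lemma plan_update_y C eta x y i j : eta != 0 ->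
  plan C eta x (update_y C c eta x y) i j =
  plan C eta x y i j * (c j 0 / \sum_k plan C eta x y k j).
Proof.
move=> eta0; set s := \sum_k _.
have s0 : 0 < s.
  rewrite /s (bigD1 i)//= ltr_pwDl ?plan_gt0// sumr_ge0// => k _.
  by rewrite ltW ?plan_gt0.
rewrite mxE [X in _ = X * _]mxE /update_y !mxE.
have -> : \sum_k (plan C eta x y)^T j k * ones R n k 0 = s.
  by apply: eq_bigr => k _; rewrite [ones _ _ _ _]mxE mulr1 mxE.
rewrite -ln_div ?posrE// -[X in _ = _ * X]lnK ?posrE ?divr_gt0// -expRD.
by congr expR; field.
Qed.

(** The cross-ratios of a Gibbs plan depend only on [C] and [eta]. *)
Lemma plan_cross_ratio C eta : exists2 kappa : R, 0 < kappa &
  forall x y i j k l, kappa * (plan C eta x y i l * plan C eta x y k j) <=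
    plan C eta x y i j * plan C eta x y k l.
Proof.
pose f (p : ('I_n * 'I_n) * ('I_n * 'I_n)) : R :=
  expR (eta * (C p.1.1 p.2.2 + C p.2.1 p.1.2 - C p.1.1 p.1.2 - C p.2.1 p.2.2)).
have [kappa k0 kf] := pos_lower_bound (fun p => expR_gt0 _ : 0 < f p).
exists kappa => // x y i j k l.
have -> : plan C eta x y i j * plan C eta x y k l =
    f ((i, j), (k, l)) * (plan C eta x y i l * plan C eta x y k j).
  by rewrite !mxE /f /= -!expRD; congr expR; ring.
by rewrite ler_wpM2r// mulr_ge0// ltW ?plan_gt0.
Qed.

Section Iterates.
Variables (C : 'M[R]_n) (eta : R) (x0 y0 : 'cV[R]_n).
Hypothesis eta_gt0 : 0 < eta.

Let P t := sinkhorn_plan C r c eta x0 y0 t.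

Let eta0 : eta != 0. Proof. by rewrite gt_eqF. Qed.

Lemma sinkhorn_planS t i j : P t.+1 i j =
  P t i j * (r i 0 / \sum_k P t i k) *
    (c j 0 / \sum_l P t l j * (r l 0 / \sum_k P t l k)).
Proof.
rewrite /P /sinkhorn_plan /sinkhorn iterS -/(sinkhorn C r c eta x0 y0 t).
set z := sinkhorn _ _ _ _ _ _ _.
rewrite /sinkhorn_step /= plan_update_y// plan_update_x//.
by congr (_ * (_ / _)); apply: eq_bigr => l _; rewrite plan_update_x.
Qed.

Lemma sinkhorn_plan_gt0 t i j : 0 < P t i j.
Proof. exact: plan_gt0. Qed.

Lemma sinkhorn_plan_col t j : \sum_i P t.+1 i j = c j 0.
Proof.
under eq_bigr do rewrite sinkhorn_planS.
rewrite -mulr_suml mulrC divfK// gt_eqF//.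
rewrite (bigD1 j)//= ltr_pwDl//.
  by rewrite mulr_gt0 ?divr_gt0 ?sinkhorn_plan_gt0// (bigD1 j)//= ltr_pwDl
    ?sinkhorn_plan_gt0// sumr_ge0// => k _; rewrite ltW ?sinkhorn_plan_gt0.
apply: sumr_ge0 => l _; rewrite mulr_ge0 ?(ltW (sinkhorn_plan_gt0 _ _ _))//.
rewrite divr_ge0 ?(ltW (r_gt0 _))// sumr_ge0// => k _.
by rewrite ltW ?sinkhorn_plan_gt0.
Qed.

(** After one iteration, the entries are bounded below uniformly in time. *)
Lemma sinkhorn_plan_lower : exists2 p0 : R, 0 < p0 &
  forall t i j, p0 <= P t.+1 i j.
Proof.
have [kappa k0 cross] := plan_cross_ratio C eta.
have [p0 p0_gt0 p0_le] : exists2 p0 : R, 0 < p0 &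
    forall p : 'I_n * 'I_n, p0 <= kappa * r p.1 0 * c p.2 0.
  by apply: pos_lower_bound => p; rewrite !mulr_gt0.
exists p0 => // t i j; apply: le_trans (p0_le (i, j)) _ => /=.
rewrite sinkhorn_planS; set P' := P t i j * _; set S := \sum_l _.
pose z := sinkhorn C r c eta x0 y0 t.
have P'E k l : plan C eta (update_x C r eta z.1 z.2) z.2 k l =
    P t k l * (r k 0 / \sum_m P t k m) by exact: plan_update_x.
have P'r k : \sum_l P t k l * (r k 0 / \sum_m P t k m) = r k 0.
  rewrite -mulr_suml mulrC divfK// gt_eqF// (bigD1 k)//= ltr_pwDl
    ?sinkhorn_plan_gt0// sumr_ge0// => l _.
  by rewrite ltW ?sinkhorn_plan_gt0.
have S0 : 0 < S.
  rewrite /S (bigD1 i)//= -P'E ltr_pwDl ?plan_gt0// sumr_ge0// => k _.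
  by rewrite -P'E ltW ?plan_gt0.
have : kappa * r i 0 * S <= P'.
  rewrite -[leRHS]mulr1 -(sum_r r_gt0 r_sum1) /S mulr_sumr mulr_sumr.
  apply: ler_sum => k _; rewrite -[X in _ <= _ * X](P'r k) -[X in kappa * X](P'r i).
  rewrite mulr_sumr mulr_suml mulr_sumr; apply: ler_sum => l _.
  have := cross (update_x C r eta z.1 z.2) z.2 i j k l.
  by rewrite !P'E mulrA.
by move=> h; rewrite [leRHS]mulrCA [leLHS]mulrC ler_pM2l// ler_pdivlMr.
Qed.

Lemma sinkhorn_marginal_rate : exists2 p0 : R, 0 < p0 <= 1 &
  forall t, (forall i j, p0 <= P t.+1 i j) /\
    \sum_i `|r i 0 - \sum_j P t.+1 i j| <= 2 * (1 - p0) ^+ t.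
Proof.
have [p0 p0_gt0 Pp0] := sinkhorn_plan_lower.
have [i0 _|n0] := pickP 'I_n; last first.
  have := sum_r r_gt0 r_sum1; rewrite big_pred0 => [/eqP|i]; last first.
    by have := n0 i.
  by rewrite eq_sym oner_eq0.
have c1 : c i0 0 <= 1.
  rewrite -(sum_c c_gt0 c_sum1) (bigD1 i0)//= lerDl sumr_ge0// => k _.
  exact: ltW.
have p01 : p0 <= 1.
  apply: le_trans (Pp0 0%N i0 i0) _; apply: le_trans c1.
  rewrite -(sinkhorn_plan_col 0 i0) (bigD1 i0)//= lerDl sumr_ge0// => k _.
  by rewrite ltW ?sinkhorn_plan_gt0.
exists p0; first by rewrite p0_gt0.
move=> t; split; first exact: Pp0.
elim: t => [|t IH].
  rewrite expr0 mulr1.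
  apply: (@le_trans _ _ (\sum_i (r i 0 + \sum_j P 1 i j))).
    apply: ler_sum => i _; apply: le_trans (ler_normB _ _) _.
    rewrite (gtr0_norm (r_gt0 i)) ger0_norm// sumr_ge0// => k _.
    by rewrite ltW ?sinkhorn_plan_gt0.
  rewrite big_split /= (sum_r r_gt0 r_sum1) exchange_big /=.
  under eq_bigr do rewrite sinkhorn_plan_col.
  by rewrite (sum_c c_gt0 c_sum1); lra.
under eq_bigr do under eq_bigr do rewrite sinkhorn_planS.
apply: le_trans (scaling_contraction (ltW p0_gt0) (Pp0 t)
  (sinkhorn_plan_gt0 t.+1) (sinkhorn_plan_col t) (fun=> erefl)
  (fun=> erefl)) _.
by rewrite exprS mulrCA ler_wpM2l ?subr_ge0.
Qed.

(** Geometric decay dominates [1 / sqrt t]. *)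
Lemma geometric_le_sqrt (p : R) t : 0 < p <= 1 ->
  (1 - p) ^+ t <= p^-1 / Num.sqrt t.+1%:R.
Proof.
move=> /andP[p_gt0 p1].
have q0 : 0 <= 1 - p by rewrite subr_ge0.
have bern : (1 - p) ^+ t * (1 + t%:R * p) <= 1.
  elim: t => [|t IH]; first by rewrite mul0r addr0 expr0 mulr1.
  apply: le_trans IH; rewrite exprS mulrAC mulrC ler_wpM2l ?exprn_ge0//.
  rewrite -natr1; have : 0 <= t%:R :> R by [].
  by have := sqr_ge0 p; nra.
have s0 : 0 < Num.sqrt t.+1%:R :> R by rewrite sqrtr_gt0.
have st : Num.sqrt t.+1%:R <= t.+1%:R :> R.
  rewrite -{2}(@sqr_sqrtr _ t.+1%:R)// expr2 ler_peMl ?(ltW s0)//.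
  by rewrite -[leLHS]sqrtr1 ler_sqrt// ler1n.
rewrite ler_pdivlMr// -[leRHS]mul1r ler_pdivlMr//.
rewrite (le_trans _ bern)// -mulrA ler_wpM2l ?exprn_ge0//.
apply: (@le_trans _ _ (t.+1%:R * p)); first by rewrite ler_wpM2r// ltW.
by rewrite -natr1 mulrDl mul1r addrC lerD2r.
Qed.

Lemma sinkhorn_near_face : exists2 K : R, 0 <= K & forall t, (0 < t)%N ->
  exists2 X, opt_face C r c X &
    norm1 (X - P t) <= sinkhorn_error n eta (vertex_gap C r c) (K ^+ 2) t.
Proof.
have [p0 p01 rate] := sinkhorn_marginal_rate.
have /andP[p0_gt0 _] := p01.
have K0 : 0 <= (3 + 2 / p0) * (2 / p0) by rewrite mulr_ge0 ?addr_ge0 ?divr_ge0 ?ltW.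
exists ((3 + 2 / p0) * (2 / p0)) => // -[//|t] _; have [Pp0 err] := rate t.
have [X XF XP] := plan_near_face r_gt0 c_gt0 r_sum1 c_sum1 eta_gt0 p0_gt0
  (sinkhorn_plan_col t) Pp0.
exists X => //; apply: le_trans XP _; rewrite /sinkhorn_error lerD2l.
rewrite sqrtr_sqr ger0_norm// -mulrA -mulrA; apply: ler_wpM2l.
  by rewrite addr_ge0 ?divr_ge0 ?ltW.
apply: le_trans err _; rewrite ler_wpM2l//; exact: geometric_le_sqrt.
Qed.

End Iterates.
End Scaling.

(** * The Hessian of the Lyapunov potential *)

Section DirectionalDerivative.
Variables (R : realType) (V : normedModType R).
Implicit Types (f : V -> R) (z v : V).

(** A directional derivative is a derivative along a line. *)
Lemma is_derive_lineP f z v (df : R) :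
  is_derive z v f df <-> is_derive (0 : R) 1 (fun h : R => f (h *: v + z)) df.
Proof.
have E : (fun h : R => h^-1 *: ((f \o shift z) (h *: v) - f z)) =
  (fun h : R => h^-1 *: (((fun k : R => f (k *: v + z)) \o shift 0) (h *: 1)
                         - f (0 *: v + z))).
  by apply/funext => h /=; rewrite addr0 [_%:A]mulr1 scale0r add0r.
split=> -[D1 D2]; split.
- exact: (derivable1P f z v).1 D1.
- by rewrite -D2 /derive E.
- exact: (derivable1P f z v).2 D1.
- by rewrite -D2 /derive E.
Qed.

Lemma is_derive_expR_comp f z v (df : R) :
  is_derive z v f df -> is_derive z v (fun u => expR (f u)) (df * expR (f z)).
Proof.
move=> /is_derive_lineP fz; apply/is_derive_lineP.
have := @is_derive1_comp _ expR (fun h : R => f (h *: v + z)) 0 _ _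
  (is_derive_expR _) fz.
by rewrite scale0r add0r mulrC.
Qed.

Lemma is_derive_sumf n (F : 'I_n -> V -> R) z v (dF : 'I_n -> R) :
  (forall i, is_derive z v (F i) (dF i)) ->
  is_derive z v (fun u => \sum_i F i u) (\sum_i dF i).
Proof.
move=> H; have -> : (fun u => \sum_i F i u) = \sum_i F i.
  by apply/funext => u; rewrite fct_sumE.
exact: is_derive_sum.
Qed.

Lemma is_derive_mull f z v (a df : R) :
  is_derive z v f df -> is_derive z v (fun u => a * f u) (a * df).
Proof. by move=> fz; exact: (is_deriveZ a fz). Qed.

Lemma is_derive_addf f g z v (df dg : R) : is_derive z v f df ->
  is_derive z v g dg -> is_derive z v (fun u => f u + g u) (df + dg).
Proof. by move=> fz gz; exact: (is_deriveD fz gz). Qed.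

Lemma is_derive_cstf z v (a : R) : is_derive z v (fun=> a) 0.
Proof. exact: is_derive_cst. Qed.

End DirectionalDerivative.

Lemma is_derive_coord (R : realType) m (z v : 'cV[R]_m) i :
  is_derive z v (fun u : 'cV[R]_m => u i 0) (v i 0).
Proof.
apply/is_derive_lineP.
have -> : (fun h : R => (h *: v + z) i 0) = (fun h => h * v i 0 + z i 0).
  by apply/funext => h; rewrite !mxE.
by apply: is_derive_eq; rewrite scaler0 add0r addr0 [_%:A]mulr1.
Qed.

Section Hessian.
Variables (R : realType) (n : nat) (C : 'M[R]_n) (r c : 'cV[R]_n) (eta : R).
Hypothesis eta_gt0 : 0 < eta.
Implicit Types (z v w : 'cV[R]_(n + n)) (X : 'M[R]_n).

(** The increment of the exponent [x_i + y_j] in the direction [v]. *)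
Definition pair_increment v (i j : 'I_n) : R :=
  v (lshift n i) 0 + v (rshift n j) 0.

Let P z := plan C eta (usubmx z) (dsubmx z).

Lemma is_derive_plan z v i j :
  is_derive z v (fun u => P u i j) (eta * pair_increment v i j * P z i j).
Proof.
have PE u : P u i j =
    expR (eta * (- C i j + (u (lshift n i) 0 + u (rshift n j) 0)) + - 1).
  by rewrite !mxE addrA.
have -> : (fun u => P u i j) = (fun u : 'cV[R]_(n + n) =>
    expR (eta * (- C i j + (u (lshift n i) 0 + u (rshift n j) 0)) + - 1)).
  by apply/funext => u.
rewrite PE; apply: is_derive_expR_comp.
have -> : eta * pair_increment v i j =
    eta * (0 + (v (lshift n i) 0 + v (rshift n j) 0)) + 0.
  by rewrite add0r addr0.
apply: (is_derive_addf _ (is_derive_cstf _ _ _)).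
apply: is_derive_mull; apply: (is_derive_addf (is_derive_cstf _ _ _)).
by apply: is_derive_addf; exact: is_derive_coord.
Qed.

Lemma derive_lyapunov z v :
  'D_v (fun u => lyapunov C r c eta (usubmx u) (dsubmx u)) z =
  - 1 * (\sum_i \sum_j pair_increment v i j * P z i j)
  + (\sum_i r i 0 * v (lshift n i) 0 + \sum_j c j 0 * v (rshift n j) 0).
Proof.
have -> : (fun u => lyapunov C r c eta (usubmx u) (dsubmx u)) =
  (fun u => - eta^-1 * (\sum_i \sum_j P u i j)
    + (\sum_i r i 0 * u (lshift n i) 0 + \sum_j c j 0 * u (rshift n j) 0)).
  apply/funext => u; rewrite /lyapunov -addrA mulNr.
  congr (- (_ * _) + (_ + _)).
  - by apply: eq_bigr => i _; apply: eq_bigr => j _; rewrite !mxE.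
  - by apply: eq_bigr => i _; rewrite mxE.
  - by apply: eq_bigr => i _; rewrite mxE.
apply: derive_val; apply: is_derive_addf; last first.
  apply: is_derive_addf; apply: is_derive_sumf => i;
    exact/is_derive_mull/is_derive_coord.
have -> : - 1 * (\sum_i \sum_j pair_increment v i j * P z i j) =
    - eta^-1 * (\sum_i \sum_j (eta * pair_increment v i j * P z i j)).
  rewrite mulN1r mulNr mulr_sumr; congr (- _); apply: eq_bigr => i _.
  by rewrite mulr_sumr; apply: eq_bigr => j _; field; rewrite gt_eqF.
apply: is_derive_mull; apply: is_derive_sumf => i; apply: is_derive_sumf => j.
exact: is_derive_plan.
Qed.

Lemma lyapunov_hessianE x y a b : lyapunov_hessian C r c eta x y a b =
  - eta * \sum_i \sum_j pair_increment (delta_mx a 0) i j *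
                        pair_increment (delta_mx b 0) i j * plan C eta x y i j.
Proof.
rewrite mxE /=.
have -> : 'D_(delta_mx a 0) (fun u =>
    lyapunov C r c eta (usubmx u) (dsubmx u)) = (fun z =>
  - 1 * (\sum_i \sum_j pair_increment (delta_mx a 0) i j * P z i j)
  + (\sum_i r i 0 * (delta_mx a 0 : 'cV[R]_(n + n)) (lshift n i) 0
     + \sum_j c j 0 * (delta_mx a 0 : 'cV[R]_(n + n)) (rshift n j) 0)).
  by apply/funext => z; exact: derive_lyapunov.
apply: derive_val.
have -> : - eta * \sum_i \sum_j pair_increment (delta_mx a 0) i j *
    pair_increment (delta_mx b 0) i j * plan C eta x y i j =
  - 1 * (\sum_i \sum_j pair_increment (delta_mx a 0) i j *
     (eta * pair_increment (delta_mx b 0) i j * P (col_mx x y) i j)) + 0.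
  rewrite addr0 mulN1r mulNr mulr_sumr; congr (- _); apply: eq_bigr => i _.
  rewrite mulr_sumr; apply: eq_bigr => j _.
  by rewrite /P col_mxKu col_mxKd; ring.
apply: (is_derive_addf _ (is_derive_cstf _ _ _)).
apply: is_derive_mull; apply: is_derive_sumf => i; apply: is_derive_sumf => j.
by apply: is_derive_mull; exact: is_derive_plan.
Qed.

Lemma pair_increment_l k i j :
  pair_increment (delta_mx (lshift n k) 0) i j = (i == k)%:R.
Proof.
rewrite /pair_increment !mxE eq_lshift eq_rlshift eqxx !andbT /=.
by rewrite mulr0n addr0.
Qed.

Lemma pair_increment_r k i j :
  pair_increment (delta_mx (rshift n k) 0) i j = (j == k)%:R.
Proof.
rewrite /pair_increment !mxE eq_rshift eq_lrshift eqxx !andbT /=.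
by rewrite mulr0n add0r.
Qed.

Lemma sum_deltas (F : 'I_n -> 'I_n -> R) k l :
  \sum_i \sum_j (i == k)%:R * (j == l)%:R * F i j = F k l.
Proof.
rewrite (bigD1 k)//= (bigD1 l)//= !eqxx !mul1r !big1 ?addr0// => [i ik|j jl].
  by rewrite big1// => j _; rewrite (negPf ik) !mul0r.
by rewrite (negPf jl) mulr0 mul0r.
Qed.

Lemma lyapunov_hessian_block x y (H := lyapunov_hessian C r c eta x y) :
  [/\ ursubmx H = - eta *: plan C eta x y,
      dlsubmx H = - eta *: (plan C eta x y)^T,
      (forall i j, i != j -> ulsubmx H i j = 0)
    & forall i j, i != j -> drsubmx H i j = 0].
Proof.
split.
- apply/matrixP => i j; rewrite mxE mxE /H lyapunov_hessianE [RHS]mxE.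
  under eq_bigr do under eq_bigr do rewrite pair_increment_l pair_increment_r.
  by rewrite sum_deltas.
- apply/matrixP => i j; rewrite mxE mxE /H lyapunov_hessianE [RHS]mxE.
  under eq_bigr do under eq_bigr do
    rewrite pair_increment_l pair_increment_r [X in X * _]mulrC.
  by rewrite sum_deltas [in RHS]mxE.
- move=> i j ij; rewrite mxE mxE /H lyapunov_hessianE big1 ?mulr0// => k _.
  apply: big1 => l _; rewrite !pair_increment_l.
  by have [->|_] := eqVneq k i; rewrite ?(negPf ij) ?mulr0 !mul0r.
- move=> i j ij; rewrite mxE mxE /H lyapunov_hessianE big1 ?mulr0// => k _.
  apply: big1 => l _; rewrite !pair_increment_r.
  by have [->|_] := eqVneq l i; rewrite ?(negPf ij) ?mulr0 !mul0r.
Qed.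

Lemma norm0_sum m k (M : 'M[R]_(m, k)) :
  norm0 M = (\sum_i \sum_j (M i j != 0%R))%N.
Proof.
rewrite norm0E pair_bigA -sum1_card big_mkcond; apply: eq_bigr => p _.
by rewrite inE; case: (_ == _).
Qed.

Lemma norm0_block m1 m2 k1 k2 (M1 : 'M[R]_(m1, k1)) (M2 : 'M[R]_(m1, k2))
    (M3 : 'M[R]_(m2, k1)) (M4 : 'M[R]_(m2, k2)) :
  norm0 (block_mx M1 M2 M3 M4) = (norm0 M1 + norm0 M2 + (norm0 M3 + norm0 M4))%N.
Proof.
rewrite !norm0_sum big_split_ord /= -!big_split /=.
by congr (_ + _)%N; apply: eq_bigr => i _; rewrite big_split_ord /=;
  congr (_ + _)%N; apply: eq_bigr => j _;
  rewrite ?block_mxEul ?block_mxEur ?block_mxEdl ?block_mxEdr.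
Qed.

Lemma norm1_block m1 m2 k1 k2 (M1 : 'M[R]_(m1, k1)) (M2 : 'M[R]_(m1, k2))
    (M3 : 'M[R]_(m2, k1)) (M4 : 'M[R]_(m2, k2)) :
  norm1 (block_mx M1 M2 M3 M4) = norm1 M1 + norm1 M2 + (norm1 M3 + norm1 M4).
Proof.
rewrite /norm1 big_split_ord /= -!big_split /=.
by congr (_ + _); apply: eq_bigr => i _; rewrite big_split_ord /=;
  congr (_ + _); apply: eq_bigr => j _;
  rewrite ?block_mxEul ?block_mxEur ?block_mxEdl ?block_mxEdr.
Qed.

Lemma norm0_tr m k (M : 'M[R]_(m, k)) : norm0 M^T = norm0 M.
Proof.
rewrite !norm0_sum exchange_big; apply: eq_bigr => i _; apply: eq_bigr => j _.
by rewrite mxE.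
Qed.

Lemma norm1_tr m k (M : 'M[R]_(m, k)) : norm1 M^T = norm1 M.
Proof.
rewrite /norm1 exchange_big; apply: eq_bigr => i _; apply: eq_bigr => j _.
by rewrite mxE.
Qed.

Lemma norm0Z_le m k a (M : 'M[R]_(m, k)) : (norm0 (a *: M) <= norm0 M)%N.
Proof.
rewrite !norm0_sum; apply: leq_sum => i _; apply: leq_sum => j _.
by rewrite mxE mulf_eq0; case: (M i j == 0); rewrite ?orbT ?leq_b1.
Qed.

Lemma norm0_diag_le (M : 'M[R]_n) : (forall i j, i != j -> M i j = 0) ->
  (norm0 M <= n)%N.
Proof.
move=> Mdiag; rewrite norm0_sum -[leqRHS]card_ord -sum1_card.
apply: leq_sum => i _; rewrite (bigD1 i)//= big1 ?addn0 ?leq_b1// => j ji.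
by rewrite Mdiag ?eqxx// eq_sym.
Qed.

(** Replacing the two off-diagonal blocks of the Hessian by multiples of a
    sparse matrix [X] close to the plan. *)
Lemma lyapunov_hessian_sparse x y X lambda eps : (0 < n)%N ->
  tau X <= lambda -> norm1 (X - plan C eta x y) <= eps ->
  is_sparse (lambda / 2 + (2 * n%:R)^-1) (2 * eta * eps)
    (lyapunov_hessian C r c eta x y).
Proof.
move=> n0 Xl Xeps; set H := lyapunov_hessian _ _ _ _ _ _.
have [Hur Hdl Hul Hdr] := lyapunov_hessian_block x y.
have nR : 0 < n%:R :> R by rewrite ltr0n.
exists (block_mx (ulsubmx H) (- eta *: X) (- eta *: X^T) (drsubmx H)); split.
- apply: (@le_trans _ _ (tau X / 2 + (2 * n%:R)^-1)); last first.
    by rewrite lerD2r ler_wpM2r.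
  rewrite /tau norm0_block.
  have -> : (norm0 X)%:R / (n * n)%:R / 2 + (2 * n%:R)^-1 =
      (n + norm0 X + (norm0 X + n))%:R / ((n + n) * (n + n))%:R :> R.
    by rewrite !(natrD, natrM); field; rewrite !gt_eqF ?addr_gt0.
  rewrite ler_wpM2r ?invr_ge0// ler_nat.
  apply: leq_add; apply: leq_add; do ?exact: norm0_diag_le.
    exact: norm0Z_le.
  by rewrite -(norm0_tr X); exact: norm0Z_le.
- rewrite -{1}[H]submxK Hur Hdl opp_block_mx add_block_mx !subrr norm1_block.
  have zero1 : norm1 (0 : 'M[R]_n) = 0.
    by rewrite /norm1 big1// => i _; rewrite big1// => j _; rewrite mxE normr0.
  rewrite zero1 add0r addr0 -!scalerBr -linearB /= !norm1Z norm1_tr.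
  rewrite normrN gtr0_norm// -mulr2n -mulrA -[leLHS]mulr_natl.
  rewrite ler_wpM2l// ler_wpM2l ?(ltW eta_gt0)//.
  by rewrite -opprB -scaleN1r norm1Z normrN normr1 mul1r.
Qed.

End Hessian.

(** * Uniqueness of the optimal plan *)

Section Uniqueness.
Variables (R : realType) (n : nat) (r c : 'cV[R]_n).
Hypotheses (r_gt0 : forall i, 0 < r i 0) (c_gt0 : forall i, 0 < c i 0).
Hypotheses (r_sum1 : norm1 r = 1) (c_sum1 : norm1 c = 1).
Implicit Types (C P S V W : 'M[R]_n).

Lemma dim_gt0 : (0 < n)%N.
Proof.
have [i0 _|n0] := pickP 'I_n; first exact: leq_ltn_trans (ltn_ord i0).
have := sum_r r_gt0 r_sum1; rewrite big_pred0 => [/eqP|i]; last first.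
  by have := n0 i.
by rewrite eq_sym oner_eq0.
Qed.

(** If the optimal vertex [V] is unique, every plan other than [V] costs strictly
    more; this property is convex and holds at the vertices. *)
Lemma unique_opt_vertex_solution C V : opt_vertices C r c V ->
  (forall W, opt_vertices C r c W -> W = V) ->
  forall S, ot_solution C r c S -> S = V.
Proof.
move=> VO Vuniq S [Spol Smin].
have Vsol := opt_vertex_solution VO.
pose A := [set P | cost C V <= cost C P /\ (cost C P = cost C V -> P = V)].
suff [_] : A S.
  by apply; apply/eqP; rewrite eq_le (Smin _ Vsol.1) (Vsol.2 _ Spol).
apply: polytope_ind Spol => [P Q s [P1 P2] [Q1 Q2] s01|W WV].
  split; first exact: cost_ge_convex.
  have /andP[s0 s1] := s01; rewrite costD !costZ => E.
  have [sE|sn0] := eqVneq s 0.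
    move: E; rewrite sE subr0 mul0r add0r mul1r scale0r add0r scale1r.
    exact: Q2.
  have [sE|sn1] := eqVneq s 1.
    move: E; rewrite sE subrr mul0r addr0 mul1r scale0r addr0 scale1r.
    exact: P2.
  have s0' : 0 < s by rewrite lt_neqAle eq_sym sn0.
  have s1' : 0 < 1 - s by rewrite subr_gt0 lt_neqAle sn1.
  have hP : 0 <= s * (cost C P - cost C V) by rewrite mulr_ge0 ?subr_ge0.
  have hQ : 0 <= (1 - s) * (cost C Q - cost C V).
    by rewrite mulr_ge0 ?subr_ge0.
  have /eqP : s * (cost C P - cost C V) = 0 by lra.
  rewrite mulf_eq0 (gt_eqF s0') subr_eq0 /= => /eqP /P2 ->.
  have /eqP : (1 - s) * (cost C Q - cost C V) = 0 by lra.
  rewrite mulf_eq0 (gt_eqF s1') subr_eq0 /= => /eqP /Q2 ->.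
  by rewrite -scalerDl addrC subrK scale1r.
split=> [|E]; first exact: VO.2.
by apply: Vuniq; split=> // Q QV; rewrite E; exact: VO.2.
Qed.

(** Two optimal plans force two optimal vertices [V] and [W], so [C] lies on the
    hyperplane orthogonal to [V - W]; there are finitely many such pairs. *)
Lemma nonunique_costs_null : lebesgue_null (nonunique_costs r c).
Proof.
have /finite_seqP[s sE] := vertices_finite r c.
pose pairs := [seq (V, W) | V <- s, W <- s].
pose D k : 'M[R]_n := let p := nth (0, 0) pairs k in
  if p.1 - p.2 == 0 then const_mx 1 else p.1 - p.2.
apply: (@lebesgue_null_sub _ _ _ (\bigcup_k [set C | cost C (D k) = 0])).
  move=> C [P [Q [Psol Qsol PQ]]].
  have [V VO] := opt_vertices_neq0 r_gt0 c_gt0 r_sum1 c_sum1 C.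
  have [W [WO WV]] : exists W, opt_vertices C r c W /\ W <> V.
    apply/not_existsP => H; apply: PQ.
    have Vuniq W : opt_vertices C r c W -> W = V.
      by move=> WO; apply: contrapT => WV; apply: (H W).
    rewrite (unique_opt_vertex_solution VO Vuniq Psol).
    by rewrite (unique_opt_vertex_solution VO Vuniq Qsol).
  have WVs : (W, V) \in pairs.
    by apply: allpairs_f; have := WO.1; have := VO.1; rewrite sE.
  exists (index (W, V) pairs) => //=; rewrite /D nth_index//=.
  rewrite subr_eq0; case: eqP => // _.
  rewrite -scaleN1r costD costZ mulN1r (opt_vertices_cost WO VO).
  exact: subrr.
apply: lebesgue_null_bigcup => k; apply: hyperplane_null; rewrite /D.
case: ifP => [_|/negbT//]; apply/matrix0Pn.
exists (Ordinal dim_gt0), (Ordinal dim_gt0).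
by rewrite mxE oner_eq0.
Qed.

Lemma unique_face C V : ~ nonunique_costs r c C -> opt_vertices C r c V ->
  opt_face C r c = [set V].
Proof.
move=> Cuniq VO; apply/seteqP; split => [M MF|_ ->]; last exact: sub_conv_hull.
apply: contrapT => MV; apply: Cuniq; exists M, V; split=> //.
  exact: opt_face_solution.
exact: opt_vertex_solution.
Qed.

Lemma unique_tau C V : ~ nonunique_costs r c C -> opt_vertices C r c V ->
  tau_set (opt_face C r c) = tau V.
Proof.
by move=> Cuniq VO; rewrite /tau_set (unique_face Cuniq VO) image_set1 sup1.
Qed.

End Uniqueness.

Lemma tau_le_tau_set (R : realType) m k (F : set 'M[R]_(m, k)) M :
  F M -> tau M <= tau_set F.
Proof.
move=> FM; apply: ub_le_sup; last by exists M.
exists (#|{: 'I_m * 'I_k}|%:R / (m * k)%:R) => _ [N _ <-].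
by rewrite /tau ler_wpM2r ?invr_ge0// ler_nat norm0E; exact: max_card.
Qed.

Lemma dist1_le (R : realType) n (F : set 'M[R]_n) P M : F M ->
  dist1 F P <= norm1 (M - P).
Proof.
move=> FM; apply: ge_inf; last by exists M.
by exists 0 => _ [N _ <-]; exact: norm1_ge0.
Qed.

Theorem theorem1 (R : realType) (n : nat) (C : 'M[R]_n)
    (r c x_init y_init : 'cV[R]_n)
    (r_gt0 : forall i, 0 < r i 0) (c_gt0 : forall i, 0 < c i 0)
    (r_sum1 : norm1 r = 1) (c_sum1 : norm1 c = 1) :
  let Delta := vertex_gap C r c in
  let F := opt_face C r c in
  let lambda := tau_set F in
  (exists (t1 : nat) (q : R -> R),
    (forall eta, 0 <= q eta) /\
    forall eta : R, ((1 + 2 * ln n%:R)%:E / Delta < eta%:E)%E ->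
    forall t : nat, (t1 < t)%N ->
    let eps := sinkhorn_error n eta Delta (q eta) t in
    let z := sinkhorn C r c eta x_init y_init t in
    let P := sinkhorn_plan C r c eta x_init y_init t in
    [/\ dist1 F P <= eps,
        is_sparse lambda eps P
      & is_sparse (lambda / 2 + (2 * n%:R)^-1) (2 * eta * eps)
          (lyapunov_hessian C r c eta z.1 z.2)])
  /\ lebesgue_null (nonunique_costs r c)
  /\ (forall C' : 'M[R]_n, ~ nonunique_costs r c C' ->
        exists! P : 'M[R]_n, ot_solution C' r c P)
  /\ (~ nonunique_costs r c C -> lambda <= 2 / n%:R)
  /\ (~ nonunique_costs r c C ->
        r = const_mx n%:R^-1 -> c = const_mx n%:R^-1 -> lambda = n%:R^-1).
Proof.
move=> Delta F lambda.
have n0 := dim_gt0 r_gt0 r_sum1.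
have nR : 0 < n%:R :> R by rewrite ltr0n.
have [V VO] := opt_vertices_neq0 r_gt0 c_gt0 r_sum1 c_sum1 C.
split; last split; last split; last split.
- have rate (eta : R) : exists K : R, 0 <= K /\ (0 < eta ->
      forall t, (0 < t)%N -> exists2 X, F X &
        norm1 (X - sinkhorn_plan C r c eta x_init y_init t)
          <= sinkhorn_error n eta Delta (K ^+ 2) t).
    have [eta0|eta0] := ltP 0 eta; last by exists 0.
    have [K K0 KP] := sinkhorn_near_face r_gt0 c_gt0 r_sum1 c_sum1 C
      x_init y_init eta0.
    by exists K; split.
  have [K KP] := choice rate.
  exists 0%N, (fun eta => K eta ^+ 2); split=> [eta|eta Heta t t0 eps z P].
    exact: sqr_ge0.
  have eta0 : 0 < eta.
    rewrite -lte_fin; apply: le_lt_trans Heta.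
    rewrite mule_ge0 ?inve_ge0 ?vertex_gap_ge0// lee_fin.
    by rewrite addr_ge0// mulr_ge0// ln_ge0// ler1n.
  have [X XF XP] := (KP eta).2 eta0 t t0.
  have Xl : tau X <= lambda by exact: tau_le_tau_set.
  split.
  + exact: le_trans (dist1_le _ XF) XP.
  + exists X; split=> //.
    by rewrite -opprB -scaleN1r norm1Z normrN normr1 mul1r.
  + exact: lyapunov_hessian_sparse n0 Xl XP.
- exact: nonunique_costs_null.
- move=> C' C'uniq.
  have [P Psol] := ot_solution_neq0 r_gt0 c_gt0 r_sum1 c_sum1 C'.
  exists P; split=> // Q Qsol; apply: contrapT => PQ.
  by apply: C'uniq; exists P, Q.
- move=> Cuniq; rewrite /lambda /F (unique_tau Cuniq VO) /tau.
  rewrite natrM invfM mulrA ler_pM2r ?invr_gt0// ler_pdivrMr//.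
  by rewrite -natrM ler_nat; exact: vertex_norm0_le VO.1.
- move=> Cuniq rE cE; rewrite /lambda /F (unique_tau Cuniq VO) /tau.
  rewrite (@uniform_vertex_norm0 _ _ V)//; last by have := VO.1; rewrite {1}rE {1}cE.
  by rewrite natrM invfM mulrA divff ?gt_eqF// mul1r.
Qed.
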